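(* Let $G$ be a connected solvable algebraic group over an algebraically closed field $k$, with unipotent radical $U$, torus quotient $\mathbb{T}=G/U$, and associated preordered abelian group $(M,C)$. Let $\alpha\colon\mathbb{T}\to G$ be a section (as algebraic groups) of the short exact sequence $$0\to U\xrightarrow{\iota}G\xrightarrow{\pi}\mathbb{T}\to0.$$ Let $V$ be a finite dimensional representation of $G$. The action of $\alpha(\mathbb{T})$ on $V$ induces a decomposition $V=\bigoplus_{\mu\in M}V_\mu$ into weight spaces, and one can define a multifiltration $F$ on $V$ indexed by $(M,C)$ by $$F^mV=\bigoplus_{\mu\ge m}V_\mu,\qquad m\in M.$$ Then the following holds. 1. The multifiltration $F$ is independent of the choice of $\alpha$. 2. The multifiltration $F$ is exhaustive, separated and regular.
   Context: $M=\operatorname{Hom}(\mathbb{T},\mathbb{G}_m)$, and $V_\mu=\{v\in V:\alpha(t)v=\mu(t)v\ \forall t\in\mathbb{T}\}$. The group $\mathbb{T}$ acts on $U$ through conjugation by $\alpha(t)$, hence on the Lie algebra $\mathfrak{u}$ of $U$, giving a weight decomposition $\mathfrak{u}=\bigoplus_{m\in M}\mathfrak{u}_m^\alpha$. Let $R=\{m\in M:\mathfrak{u}_m^\alpha\ne\{0\}\}$ (a finite set) and let $C$ be the set of $m\in M$ whose image in $M_{\mathbb{Q}}=M\otimes\mathbb{Q}$ is of the form $\sum_{r\in R}a_rr$ with $a_r\in\mathbb{Q}$, $a_r\ge0$; $C$ does not depend on $\alpha$. The pair $(M,C)$ is the preordered abelian group associated to $G$, with preorder $\lambda\le\mu\iff\mu-\lambda\in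 C$. A multifiltration $F$ on $V$ indexed by $(M,C)$ is a collection of subspaces $F^\lambda V$, $\lambda\in M$, with $F^\lambda V\supset F^\mu V$ whenever $\lambda\le\mu$. For $K\subset M$ put $\widetilde K=\{\lambda\in M:\lambda\ge\mu\text{ for some }\mu\in K\}$ and $F^KV=\sum_{\lambda\in K}F^\lambda V$. $F$ is exhaustive if $V=\sum_{\lambda\in M}F^\lambda V$; separated if for every collection $\{K_\alpha\}$ of subsets of $M$ with $\bigcap_\alpha\widetilde{K_\alpha}=\emptyset$ one has $\bigcap_\alpha F^{K_\alpha}V=\{0\}$; regular if for every pair of subsets $K_1,K_2\subset M$ one has $F^{K_1}V\cap F^{K_2}V=\sum_{\mu\in\widetilde K_1\cap\widetilde K_2}F^\mu V$. *)

(* Defs.v *)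
From HB Require Import structures.
From mathcomp Require Import all_boot all_order all_algebra.
From mathcomp Require Import boolp classical_sets functions.
From mathcomp Require Import ring.

Set Implicit Arguments.
Unset Strict Implicit.
Unset Printing Implicit Defensive.

Import Order.TTheory GRing.Theory Num.Theory.

Local Open Scope classical_set_scope.
Local Open Scope quotient_scope.
Local Open Scope ring_scope.

(* M (x)_Z Q. Every element of M (x) Q is a pure tensor m (x) q, coded by the
   pair (m, q); m (x) q = m' (x) q' iff, for some N > 0 such that N q and N q'
   are integers, (N q) m = (N q') m' in M. *)
Section TensorQ.
Variable M : zmodType.
Implicit Types x y z : M * rat.

Definition tensQ_eq x y : bool :=
  `[< exists (N : nat) (a b : int), [/\ (0 < N)%N, x.2 * N%:R = a%:~R,
      y.2 * N%:R = b%:~R & x.1 *~ a = y.1 *~ b] >].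

Lemma tensQ_eq_refl : reflexive tensQ_eq.
Proof.
move=> x; apply/asboolP; exists `|denq x.2|%N, (numq x.2), (numq x.2).
have d0 := denq_gt0 x.2.
have E : x.2 * `|denq x.2|%:R = (numq x.2)%:~R.
  rewrite -[(`|_|%N)%:R]/((`|denq x.2|%N : int)%:~R) gtz0_abs //.
  by rewrite -{1}[x.2]divq_num_den mulfVK // intr_eq0 denq_neq0.
by split=> //; rewrite absz_gt0 denq_neq0.
Qed.

Lemma tensQ_eq_sym : symmetric tensQ_eq.
Proof.
by move=> x y; apply/asboolP/asboolP => -[N [a [b [N0 xE yE E]]]];
   exists N, b, a; split.
Qed.

Lemma tensQ_eq_trans : transitive tensQ_eq.
Proof.
move=> y x z /asboolP[N [a [b [N0 xE yE E]]]].
move=> /asboolP[N' [b' [c [N0' yE' zE E']]]].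
apply/asboolP; exists (N * N')%N, (a * N'%:Z), (c * N%:Z); split.
- by rewrite muln_gt0 N0.
- by rewrite natrM mulrA xE rmorphM.
- by rewrite natrM [N%:R * _]mulrC mulrA zE rmorphM.
- rewrite !mulrzA E -E' -!mulrzA; congr (_ *~ _).
  apply: (@intr_inj rat); rewrite !rmorphM /= -yE -yE'.
  by rewrite -!mulrA [N%:R * _]mulrC.
Qed.

Definition tensQ_equiv := EquivRel tensQ_eq
  tensQ_eq_refl tensQ_eq_sym tensQ_eq_trans.
Canonical tensQ_equiv.

Definition tensQ := {eq_quot tensQ_equiv}.
HB.instance Definition _ := EqQuotient.on tensQ.
HB.instance Definition _ := Choice.on tensQ.

Definition tens (m : M) (q : rat) : tensQ := \pi_tensQ (m, q).

Lemma tens_eqP m q m' q' : reflect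
  (exists (N : nat) (a b : int), [/\ (0 < N)%N, q * N%:R = a%:~R,
      q' * N%:R = b%:~R & m *~ a = m' *~ b])
  (tens m q == tens m' q').
Proof. by apply: (iffP idP) => [|h]; [rewrite eqmodE => /asboolP|
  rewrite eqmodE; apply/asboolP]. Qed.


Let mulnq_int (q : rat) (c : int) :
  exists N : nat, exists2 a : int, (0 < N)%N & q * (N%:R * c%:~R) = a%:~R.
Proof.
exists `|denq q|%N, (numq q * c); first by rewrite absz_gt0 denq_neq0.
rewrite -[(`|_|%N)%:R]/((`|denq q|%N : int)%:~R) gtz0_abs ?denq_gt0 //.
by rewrite mulrA -{1}[q]divq_num_den mulfVK ?intr_eq0 ?denq_neq0 // rmorphM.
Qed.

(* m a (x) q = m (x) a q for an integer a *)
Let tens_mulz m (a : int) q : tens (m *~ a) q = tens m (a%:~R * q).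
Proof.
have [N [b N0]] := mulnq_int q 1; rewrite mulr1 => Nq.
apply/eqP/tens_eqP; exists N, b, (a * b); split => //.
  by rewrite -mulrA Nq rmorphM.
by rewrite mulrzA.
Qed.

Let num_den (q : rat) : q * (denq q)%:~R = (numq q)%:~R.
Proof. by rewrite -{1}[q]divq_num_den mulfVK // intr_eq0 denq_neq0. Qed.

Let tens_fracs (x y z : tensQ) : exists m1 m2 m3 q,
  [/\ x = tens m1 q, y = tens m2 q & z = tens m3 q].
Proof.
have red m q e D : e != 0 -> D = denq q * e ->
    tens m q = tens (m *~ (numq q * e)) (D%:~R)^-1.
  move=> e0 ->; rewrite tens_mulz; congr tens.
  by rewrite !rmorphM /= -num_den -[_ * _ * e%:~R]mulrA mulfK // mulf_neq0 // intr_eq0.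
rewrite -[x]reprK -[y]reprK -[z]reprK.
case: (repr x) (repr y) (repr z) => [m1 q1] [m2 q2] [m3 q3].
have [d1 d2 d3] := And3 (denq_neq0 q1) (denq_neq0 q2) (denq_neq0 q3).
exists (m1 *~ (numq q1 * (denq q2 * denq q3))).
exists (m2 *~ (numq q2 * (denq q1 * denq q3))).
exists (m3 *~ (numq q3 * (denq q1 * denq q2))).
exists (denq q1 * (denq q2 * denq q3))%:~R^-1.
split; apply: red; rewrite ?mulf_neq0 //; first by rewrite mulrCA.
by rewrite mulrA mulrC.
Qed.

Definition tensQ_add (x y : tensQ) : tensQ :=
  let: (m, q) := repr x in let: (m', q') := repr y in
  tens (m *~ (numq q * denq q') + m' *~ (numq q' * denq q))
       (denq q * denq q')%:~R^-1.

Definition tensQ_scale (a : rat) (x : tensQ) : tensQ :=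
  let: (m, q) := repr x in tens m (a * q).

Let tens_addE m m' q : tensQ_add (tens m q) (tens m' q) = tens (m + m') q.
Proof.
rewrite /tensQ_add.
case E1: (repr (tens m q)) => [m1 q1]; case E2: (repr (tens m' q)) => [m2 q2].
have /eqP/tens_eqP : tens m1 q1 = tens m q by rewrite /tens -E1 reprK.
have /eqP/tens_eqP : tens m2 q2 = tens m' q by rewrite /tens -E2 reprK.
move=> [N2 [a2 [b2 [N20 h2 k2 e2]]]] [N1 [a1 [b1 [N10 h1 k1 e1]]]].
set d1 := denq q1; set d2 := denq q2.
have [d10 d20] : d1 != 0 /\ d2 != 0 by split; apply: denq_neq0.
have absd q0 : (`|denq q0|%N)%:R = (denq q0)%:~R :> rat.
  by rewrite -[LHS]/((`|denq q0|%N : int)%:~R) gtz0_abs ?denq_gt0.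
have nE (Ni : nat) ai qi : qi * Ni%:R = ai%:~R -> numq qi * Ni%:Z = ai * denq qi.
  move=> h; apply: (@intr_inj rat).
  by rewrite !rmorphM /= -num_den -h mulrAC.
have bb : b2 * N1%:Z = b1 * N2%:Z.
  by apply: (@intr_inj rat); rewrite !rmorphM /= -k1 -k2 mulrAC.
apply/eqP/tens_eqP.
exists (N1 * N2 * (`|d1| * `|d2|))%N, (N1%:Z * N2%:Z), (b1 * N2%:Z * (d1 * d2)).
split.
- by rewrite !muln_gt0 N10 N20 !absz_gt0 d10.
- rewrite !natrM !absd [LHS]mulrC -!rmorphM /= mulfK // intr_eq0 mulf_neq0 //.
- by rewrite !natrM !absd !mulrA k1 !rmorphM.
rewrite !mulrzDl; congr (_ + _); rewrite -!mulrzA.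
  rewrite (_ : _ * _ = a1 * (d1 * d2 * N2%:Z)); last first.
    by rewrite mulrACA (nE _ _ _ h1) -/d1 -/d2; ring.
  by rewrite mulrzA e1 -mulrzA; congr (_ *~ _); ring.
rewrite (_ : _ * _ = a2 * (d1 * d2 * N1%:Z)); last first.
  by rewrite [N1%:Z * _]mulrC mulrACA (nE _ _ _ h2) -/d1 -/d2; ring.
by rewrite mulrzA e2 -mulrzA -bb; congr (_ *~ _); ring.
Qed.

Let tens_scaleE a m q : tensQ_scale a (tens m q) = tens m (a * q).
Proof.
rewrite /tensQ_scale; case E: (repr (tens m q)) => [m1 q1].
have /eqP/tens_eqP : tens m1 q1 = tens m q by rewrite /tens -E reprK.
move=> [N [b [c [N0 h k e]]]]; apply/eqP/tens_eqP.
have [N' [d N'0]] := mulnq_int a 1; rewrite mulr1 => aE.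
exists (N * N')%N, (b * d), (c * d); split.
- by rewrite muln_gt0 N0.
- by rewrite natrM rmorphM /= -aE -h; ring.
- by rewrite natrM rmorphM /= -aE -k; ring.
- by rewrite !mulrzA e.
Qed.

Let addA : associative tensQ_add.
Proof.
move=> x y z; have [m1 [m2 [m3 [q [-> -> ->]]]]] := tens_fracs x y z.
by rewrite !tens_addE addrA.
Qed.

Let addC : commutative tensQ_add.
Proof.
move=> x y; have [m1 [m2 [_ [q [-> -> _]]]]] := tens_fracs x y y.
by rewrite !tens_addE addrC.
Qed.

Let tens0 q q' : tens 0 q = tens 0 q'.
Proof. by rewrite -{1}(mul0rz _ 0) -[in RHS](mul0rz _ 0) !tens_mulz !mul0r. Qed.

Let add0 : left_id (tens 0 0) tensQ_add.
Proof.
move=> x; have [m1 [_ [_ [q [-> _ _]]]]] := tens_fracs x x x.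
by rewrite (tens0 0 q) tens_addE add0r.
Qed.

Let addN : left_inverse (tens 0 0) (tensQ_scale (-1)) tensQ_add.
Proof.
move=> x; have [m1 [_ [_ [q [-> _ _]]]]] := tens_fracs x x x.
by rewrite tens_scaleE -(tens_mulz m1 (-1)) mulrNz mulr1z tens_addE addNr (tens0 0 q).
Qed.

HB.instance Definition _ :=
  GRing.isZmodule.Build tensQ addA addC add0 addN.

Let scaleA a b (x : tensQ) :
  tensQ_scale a (tensQ_scale b x) = tensQ_scale (a * b) x.
Proof.
have [m1 [_ [_ [q [-> _ _]]]]] := tens_fracs x x x.
by rewrite !tens_scaleE mulrA.
Qed.

Let scale1 : left_id 1 tensQ_scale.
Proof.
move=> x; have [m1 [_ [_ [q [-> _ _]]]]] := tens_fracs x x x.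
by rewrite !tens_scaleE mul1r.
Qed.

Let scaleDr : right_distributive tensQ_scale +%R.
Proof.
move=> a x y; have [m1 [m2 [_ [q [-> -> _]]]]] := tens_fracs x y y.
by rewrite [X in tensQ_scale _ X]tens_addE !tens_scaleE [RHS]tens_addE.
Qed.

Let scaleDl (x : tensQ) : {morph tensQ_scale^~ x : a b / a + b}.
Proof.
move=> a b; have [m1 [_ [_ [q [-> _ _]]]]] := tens_fracs x x x.
have [D [na [nb [aE bE]]]] : exists (D : rat) (na nb : int),
    a = na%:~R / D /\ b = nb%:~R / D.
  have D0 : (denq a * denq b)%:~R != 0 :> rat by rewrite intr_eq0 mulf_neq0 ?denq_neq0.
  exists (denq a * denq b)%:~R, (numq a * denq b), (numq b * denq a).
  by split; apply: (mulIf D0); rewrite mulfVK // !rmorphM /= -num_den; ring.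
have E (n : int) : tens m1 (n%:~R / D * q) = tens (m1 *~ n) (D^-1 * q).
  by rewrite tens_mulz mulrA.
rewrite aE bE -mulrDl -rmorphD /= !tens_scaleE !E.
by rewrite [RHS]tens_addE mulrzDr.
Qed.

HB.instance Definition _ :=
  GRing.Zmodule_isLmodule.Build rat tensQ scaleA scale1 scaleDr scaleDl.

Lemma tensD q : {morph tens^~ q : m m' / m + m'}.
Proof. by move=> m m'; rewrite [RHS]tens_addE. Qed.

End TensorQ.

(* Affine varieties over an algebraically closed field k, in the classical
   language: a set X of points together with its algebra k[X] of regular
   functions, a finitely generated algebra of functions X -> k whose k-algebra
   homomorphisms to k are exactly the evaluations at the points of X. *)
Section AffineVariety.
Variable k : closedFieldType.

Definition subalg (X : Type) (B : set (X -> k)) : Prop :=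
  [/\ forall c : k, B (cst c),
      forall f g, B f -> B g -> B (f + g) &
      forall f g, B f -> B g -> B (f * g)].

Definition alg_gen (X : Type) (S : set (X -> k)) : set (X -> k) :=
  smallest (@subalg X) S.

Definition alg_hom_on (X : Type) (B : set (X -> k)) (phi : (X -> k) -> k) : Prop :=
  [/\ forall c : k, phi (cst c) = c,
      forall f g, B f -> B g -> phi (f + g) = phi f + phi g &
      forall f g, B f -> B g -> phi (f * g) = phi f * phi g].

Record affine_variety (X : Type) (B : set (X -> k)) : Prop := AffineVariety {
  affine_fingen : exists n (s : 'I_n -> X -> k), B = alg_gen (range s);
  affine_separated : forall x y, (forall f, B f -> f x = f y) -> x = y;
  affine_points : forall phi, alg_hom_on B phi ->
    exists x, forall f, B f -> phi f = f x }.

(* k[X x Y] = k[X] (x) k[Y] *)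
Definition regular_prod (X Y : Type) (B : set (X -> k)) (B' : set (Y -> k)) :
    set (X * Y -> k) :=
  alg_gen ([set h | exists2 f, B f & h = f \o fst] `|`
           [set h | exists2 g, B' g & h = g \o snd]).

End AffineVariety.

Record algGroup (k : closedFieldType) := AlgGroup {
  alg_carrier :> groupType;
  regular : set (alg_carrier -> k);
  algGroup_affine : affine_variety regular;
  algGroup_mul : forall f, regular f ->
    regular_prod regular regular (fun p => f (p.1 * p.2)%g);
  algGroup_inv : forall f, regular f -> regular (fun x => f x^-1%g) }.

Arguments regular {k} G : rename.

Record algHom (k : closedFieldType) (G H : algGroup k) := AlgHom {
  alg_hom :> {multiplicative G -> H};
  alg_hom_regular : forall h, regular H h -> regular G (h \o alg_hom) }.

Definition alg_isomorphic (k : closedFieldType) (G H : algGroup k) : Prop :=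
  exists (phi : algHom G H) (psi : algHom H G), cancel phi psi /\ cancel psi phi.

Section AlgGen.
Variables (k : closedFieldType) (X : Type).
Implicit Types (S B : set (X -> k)) (f g : X -> k).

Lemma alg_gen_subalg S : subalg (alg_gen S).
Proof.
split=> [c B [[Bc _ _] _]|f g Sf Sg B BS|f g Sf Sg B BS]; first exact: Bc.
  by have [[_ BD _] _] := BS; apply: BD; [apply: Sf|apply: Sg].
by have [[_ _ BM] _] := BS; apply: BM; [apply: Sf|apply: Sg].
Qed.

Lemma alg_gen_sub S : S `<=` alg_gen S.
Proof. exact: sub_gen_smallest. Qed.

Lemma alg_gen_min S B : subalg B -> S `<=` B -> alg_gen S `<=` B.
Proof. by move=> Ba SB; apply: smallest_sub. Qed.

Lemma subalg_comp (Y : Type) (u : Y -> X) (B : set (Y -> k)) :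
  subalg B -> subalg [set f : X -> k | B (f \o u)].
Proof.
by case=> BC BD BM; split=> [c|f g|f g] /=; [exact: BC|exact: BD|exact: BM].
Qed.

Lemma alg_hom_eq S phi x : alg_hom_on (alg_gen S) phi ->
  (forall f, S f -> phi f = f x) -> forall f, alg_gen S f -> phi f = f x.
Proof.
move=> [pC pD pM] SE f Sf; have [gC gD gM] := alg_gen_subalg S.
suff [] : [set f | alg_gen S f /\ phi f = f x] f by [].
apply: (alg_gen_min _ _ Sf) => [|g Sg]; last by split; [exact: alg_gen_sub|exact: SE].
split=> [c|f1 g1 [Sf1 E1] [Sg1 E2]|f1 g1 [Sf1 E1] [Sg1 E2]].
- by split; [exact: gC|rewrite pC].
- by split; [exact: gD|rewrite pD // E1 E2].
- by split; [exact: gM|rewrite pM // E1 E2].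
Qed.

End AlgGen.

(* The multiplicative group, with k[Gm] = k[x, 1/x]. *)
Section MultiplicativeGroup.
Variable k : closedFieldType.

Record Gm_type := GmType { Gm_val : k; _ : Gm_val != 0 }.
HB.instance Definition _ := [isSub for Gm_val].
HB.instance Definition _ := [Choice of Gm_type by <:].

Lemma Gm_neq0 (x : Gm_type) : Gm_val x != 0. Proof. exact: (valP x). Qed.

Let one_neq0 : 1 != 0 :> k. Proof. exact: oner_neq0. Qed.
Let mul_neq0 (x y : Gm_type) : Gm_val x * Gm_val y != 0.
Proof. by rewrite mulf_neq0 ?Gm_neq0. Qed.
Let inv_neq0 (x : Gm_type) : (Gm_val x)^-1 != 0.
Proof. by rewrite invr_eq0 Gm_neq0. Qed.

Definition Gm_one := GmType one_neq0.
Definition Gm_mul x y := GmType (mul_neq0 x y).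
Definition Gm_inv x := GmType (inv_neq0 x).

Let mulA : associative Gm_mul.
Proof. by move=> x y z; apply: val_inj; rewrite /= mulrA. Qed.
Let mul1 : left_id Gm_one Gm_mul.
Proof. by move=> x; apply: val_inj; rewrite /= mul1r. Qed.
Let mul1' : right_id Gm_one Gm_mul.
Proof. by move=> x; apply: val_inj; rewrite /= mulr1. Qed.
Let mulV : left_inverse Gm_one Gm_inv Gm_mul.
Proof. by move=> x; apply: val_inj; rewrite /= mulVf ?Gm_neq0. Qed.
Let mulV' : right_inverse Gm_one Gm_inv Gm_mul.
Proof. by move=> x; apply: val_inj; rewrite /= divff ?Gm_neq0. Qed.

HB.instance Definition _ := isGroup.Build Gm_type mulA mul1 mul1' mulV mulV'.

Definition Gm_coord (i : 'I_2) : Gm_type -> k :=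
  if i == 0 then Gm_val else fun x => (Gm_val x)^-1.

Definition Gm_regular : set (Gm_type -> k) := alg_gen (range Gm_coord).

Lemma Gm_regular_val : Gm_regular Gm_val.
Proof. by apply: alg_gen_sub; exists 0. Qed.
Lemma Gm_regular_inv : Gm_regular (fun x => (Gm_val x)^-1).
Proof. by apply: alg_gen_sub; exists 1. Qed.

Lemma Gm_regular_min B : subalg B -> B Gm_val -> B (fun x => (Gm_val x)^-1) ->
  Gm_regular `<=` B.
Proof.
move=> Ba B0 B1; apply: alg_gen_min => // _ [i _ <-].
by rewrite /Gm_coord; case: ifP.
Qed.

Lemma Gm_affine : affine_variety Gm_regular.
Proof.
split; first by exists 2, Gm_coord.
  by move=> x y /(_ _ Gm_regular_val) /val_inj.
move=> phi phiH; have [pC _ pM] := phiH.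
have E : phi Gm_val * phi (fun x => (Gm_val x)^-1) = 1.
  rewrite -pM; [|exact: Gm_regular_val|exact: Gm_regular_inv].
  rewrite -[RHS]pC; congr phi; apply: funext => x.
  by rewrite /GRing.mul /= divff ?Gm_neq0.
have p0 : phi Gm_val != 0.
  by apply/eqP => p0; move/eqP: E; rewrite p0 mul0r eq_sym oner_eq0.
exists (GmType p0); apply: alg_hom_eq => // _ [i _ <-].
rewrite /Gm_coord; case: ifP => // _.
by apply: (mulfI p0); rewrite E /= divff.
Qed.

Lemma Gm_mul_regular f : Gm_regular f ->
  regular_prod Gm_regular Gm_regular (fun p => f (p.1 * p.2)%g).
Proof.
have [pC pD pM] := alg_gen_subalg ([set h | exists2 f, Gm_regular f & h = f \o fst] `|`
           [set h | exists2 g, Gm_regular g & h = g \o snd]).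
move: f; apply: (Gm_regular_min (subalg_comp (fun p => p.1 * p.2)%g (And3 pC pD pM))).
- apply: (pM (Gm_val \o fst) (Gm_val \o snd)); apply: alg_gen_sub.
    by left; exists Gm_val => //; exact: Gm_regular_val.
  by right; exists Gm_val => //; exact: Gm_regular_val.
- set i := fun x : Gm_type => (Gm_val x)^-1.
  rewrite /= (_ : _ \o _ = (i \o fst) * (i \o snd)); last first.
    by apply: funext => -[x y]; rewrite /i /= invfM.
  apply: pM; apply: alg_gen_sub.
    by left; exists i => //; exact: Gm_regular_inv.
  by right; exists i => //; exact: Gm_regular_inv.
Qed.

Lemma Gm_inv_regular f : Gm_regular f -> Gm_regular (fun x => f x^-1%g).
Proof.
move: f; apply: (Gm_regular_min (subalg_comp (fun x => x^-1)%g (alg_gen_subalg _))).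
  exact: Gm_regular_inv.
rewrite /= (_ : _ \o _ = Gm_val); first exact: Gm_regular_val.
by apply: funext => x; rewrite /= invrK.
Qed.

Definition Gm : algGroup k := AlgGroup Gm_affine Gm_mul_regular Gm_inv_regular.

End MultiplicativeGroup.

Section PowerGroup.
Variables (k : closedFieldType) (G : algGroup k) (n : nat).

Definition pow_coord : set ({ffun 'I_n -> G} -> k) :=
  [set h | exists i, exists2 f, regular G f & h = fun x : {ffun 'I_n -> G} => f (x i)].

Definition pow_regular : set ({ffun 'I_n -> G} -> k) := alg_gen pow_coord.

Lemma pow_regular_coord i f : regular G f -> pow_regular (fun x => f (x i)).
Proof. by move=> Gf; apply: alg_gen_sub; exists i, f. Qed.

Let regular_subalg : subalg (regular G).
Proof.
by have [m [s ->]] := affine_fingen (algGroup_affine G); exact: alg_gen_subalg.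
Qed.

Lemma pow_affine : affine_variety pow_regular.
Proof.
have [m [s Gs]] := affine_fingen (algGroup_affine G).
split.
- exists #|{: 'I_n * 'I_m}|,
    (fun j => let p := enum_val j in fun x => s p.2 (x p.1)).
  apply/seteqP; split; apply: alg_gen_min; try exact: alg_gen_subalg.
    move=> _ [i [f + ->]]; rewrite Gs; move: f.
    apply: (alg_gen_min (subalg_comp (fun x : {ffun 'I_n -> G} => x i)
      (alg_gen_subalg _))) => _ [j _ <-].
    by apply: alg_gen_sub; exists (enum_rank (i, j)) => //; rewrite enum_rankK.
  move=> _ [j _ <-]; apply: pow_regular_coord; rewrite Gs.
  by apply: alg_gen_sub; exists (enum_val j).2.
- move=> x y xy; apply/ffunP => i; apply: (affine_separated (algGroup_affine G)).
  by move=> f Gf; apply: (xy (fun x => f (x i))); exact: pow_regular_coord.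
- move=> phi phiH; have [pC pD pM] := phiH.
  have /choice[x xE] : forall i, exists x, forall f, regular G f ->
      phi (fun z => f (z i)) = f x.
    move=> i; apply: (affine_points (algGroup_affine G)
      (phi := fun f => phi (fun z => f (z i)))); split=> [c|f g Gf Gg|f g Gf Gg].
    + exact: pC.
    + by apply: pD; exact: pow_regular_coord.
    + by apply: pM; exact: pow_regular_coord.
  exists (finfun x); apply: alg_hom_eq => // _ [i [f Gf ->]].
  by rewrite xE // ffunE.
Qed.

Lemma pow_mul_regular f : pow_regular f ->
  regular_prod pow_regular pow_regular (fun p => f (p.1 * p.2)%g).
Proof.
move: f; apply: (alg_gen_min (subalg_comp (fun p => p.1 * p.2)%g (alg_gen_subalg _))).
move=> _ [i [f Gf ->]] /=.
rewrite (_ : _ \o _ = (fun p => f (p.1 * p.2)%g) \o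
    (fun p : {ffun 'I_n -> G} * {ffun 'I_n -> G} => (p.1 i, p.2 i))); last first.
  by apply: funext => -[x y]; rewrite /= ffunE.
move: (algGroup_mul Gf); move: (fun p : G * G => _).
apply: (alg_gen_min (subalg_comp _ (alg_gen_subalg _))).
move=> _ [[h Gh ->]|[h Gh ->]]; apply: alg_gen_sub; [left|right];
  by exists (fun x => h (x i)) => //; exact: pow_regular_coord.
Qed.

Lemma pow_inv_regular f : pow_regular f -> pow_regular (fun x => f x^-1%g).
Proof.
move: f; apply: (alg_gen_min (subalg_comp (fun x => x^-1)%g (alg_gen_subalg _))).
move=> _ [i [f Gf ->]] /=.
rewrite (_ : _ \o _ = fun x : {ffun 'I_n -> G} => f (x i)^-1%g); last first.
  by apply: funext => x; rewrite /= ffunE.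
exact: (pow_regular_coord i (algGroup_inv Gf)).
Qed.

Definition powGroup : algGroup k :=
  AlgGroup pow_affine pow_mul_regular pow_inv_regular.

End PowerGroup.

Definition torus (k : closedFieldType) (T : algGroup k) : Prop :=
  exists n, alg_isomorphic T (powGroup (Gm k) n).

(* Hom(T, Gm), written additively. *)
Section Characters.
Variables (k : closedFieldType) (T : algGroup k).

Definition char := algHom T (Gm k).

HB.instance Definition _ := gen_eqMixin char.
HB.instance Definition _ := gen_choiceMixin char.

Definition char_val (m : char) (t : T) : k := Gm_val (m t).

Lemma charP (m m' : char) : (forall t, char_val m t = char_val m' t) -> m = m'.
Proof.
move=> E; have {}E : (m : T -> Gm k) = m'.
  by apply: funext => t; apply: val_inj; exact: E.
case: m m' E => [m mr] [m' mr'] /= E.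
have {}E : m = m' by case: m m' E {mr mr'} => [m [[c]]] [m' [[c']]] /= E;
  subst m'; rewrite (Prop_irrelevance c c').
by subst m'; rewrite (Prop_irrelevance mr mr').
Qed.

Let regular_subalg : subalg (regular T).
Proof.
by have [m [s ->]] := affine_fingen (algGroup_affine T); exact: alg_gen_subalg.
Qed.

Lemma char_regular (m : char) : regular T (char_val m).
Proof. by apply: (alg_hom_regular m (h := @Gm_val k)); exact: Gm_regular_val. Qed.

Lemma char_regular_inv (m : char) : regular T (fun t => (char_val m t)^-1).
Proof.
by apply: (alg_hom_regular m (h := fun x => (Gm_val x)^-1)); exact: Gm_regular_inv.
Qed.

Section Build.
Variable u : T -> Gm k.
Hypothesis uM : {morph u : x y / (x * y)%g}.
Hypothesis u_regular : regular T (fun t => Gm_val (u t)).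
Hypothesis u_regular_inv : regular T (fun t => (Gm_val (u t))^-1).

HB.instance Definition _ := isMultiplicative.Build _ _ u uM.

Let u_hom h : regular (Gm k) h -> regular T (h \o u).
Proof. by move: h; apply: Gm_regular_min => //; exact: subalg_comp. Qed.

Definition char_build : char := AlgHom (alg_hom := u) u_hom.

End Build.

Let Gm_mulC : commutative (@Gm_mul k).
Proof. by move=> x y; apply: val_inj; rewrite /= mulrC. Qed.

Let zeroM : {morph (fun=> 1%g : Gm k) : x y / (x * y : T)%g >-> (x * y)%g}.
Proof. by move=> x y; rewrite mulg1. Qed.
Let addM (m m' : char) : {morph (fun t => m t * m' t)%g : x y / (x * y)%g}.
Proof.
move=> x y; rewrite !gmulfM -!mulgA; congr (_ * _)%g.
by rewrite !mulgA [(m y * m' x)%g]Gm_mulC.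
Qed.
Let oppM (m : char) : {morph (fun t => (m t)^-1)%g : x y / (x * y)%g}.
Proof. by move=> x y; rewrite gmulfM invgM [LHS]Gm_mulC. Qed.

Let regC (c : k) : regular T (fun=> c).
Proof. by have [rC _ _] := regular_subalg; exact: rC. Qed.
Let regM f g : regular T f -> regular T g -> regular T (fun t => f t * g t).
Proof. by have [_ _ rM] := regular_subalg; exact: rM. Qed.
Let add_inv (m m' : char) :
  regular T (fun t => (Gm_val (m t * m' t)%g)^-1).
Proof.
under eq_fun do rewrite /= invfM.
by apply: regM; exact: char_regular_inv.
Qed.
Let opp_inv (m : char) : regular T (fun t => (Gm_val (m t)^-1%g)^-1).
Proof. by under eq_fun do rewrite /= invrK; exact: char_regular. Qed.

Definition char_zero : char := char_build zeroM (regC _) (regC _).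
Definition char_add (m m' : char) : char :=
  char_build (addM m m') (regM (char_regular m) (char_regular m')) (add_inv m m').
Definition char_opp (m : char) : char :=
  char_build (oppM m) (char_regular_inv m) (opp_inv m).

Let addA : associative char_add.
Proof. by move=> x y z; apply: charP => t; exact: mulrA. Qed.
Let addC : commutative char_add.
Proof. by move=> x y; apply: charP => t; exact: mulrC. Qed.
Let add0 : left_id char_zero char_add.
Proof. by move=> x; apply: charP => t; exact: mul1r. Qed.
Let addN : left_inverse char_zero char_opp char_add.
Proof. by move=> x; apply: charP => t; exact: mulVf (Gm_neq0 _). Qed.

HB.instance Definition _ := GRing.isZmodule.Build char addA addC add0 addN.

End Characters.

Section GroupProperties.
Variables (k : closedFieldType) (G : algGroup k).
Implicit Types N H : set G.

Definition subgroup H : Prop :=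
  [/\ H 1%g, forall x y, H x -> H y -> H (x * y)%g & forall x, H x -> H x^-1%g].

Definition normal H : Prop := forall g x, H x -> H (g * x * g^-1)%g.

Fixpoint derived_series (n : nat) : set G :=
  if n is n'.+1 then
    smallest subgroup [set z | exists x y,
      [/\ derived_series n' x, derived_series n' y & z = [~ x, y]%g]]
  else setT.

Definition solvable : Prop := exists n, derived_series n = [set 1%g].

Definition zariski_closed N : Prop := exists2 S : set (G -> k),
  S `<=` regular G & N = [set x | forall f, S f -> f x = 0].

(* connectedness for the topology induced by the Zariski topology *)
Definition zariski_connected N : Prop :=
  forall A B : set G, zariski_closed A -> zariski_closed B ->
    N `<=` A `|` B -> N `&` (A `&` B) = set0 -> N `<=` A \/ N `<=` B.

Record rep (V : vectType k) := Rep {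
  rep_act :> G -> 'End(V);
  rep_act1 : rep_act 1%g = \1%VF;
  rep_actM : forall g h, rep_act (g * h)%g = (rep_act g \o rep_act h)%VF;
  rep_regular : forall (v : V) (l : 'Hom(V, k^o)),
    regular G (fun g => l (rep_act g v)) }.

Definition unipotent (g : G) : Prop :=
  forall (V : vectType k) (rho : rep V),
    exists n, forall v, iter n (fun w => rho g w - w) v = 0.

Definition connected_normal_unipotent N : Prop :=
  [/\ subgroup N, zariski_closed N, zariski_connected N, normal N &
      forall g, N g -> unipotent g].

(* the largest connected normal unipotent closed subgroup *)
Definition unipotent_radical N : Prop :=
  connected_normal_unipotent N /\
  forall N', connected_normal_unipotent N' -> N' `<=` N.

End GroupProperties.

(* iota is a closed immersion onto ker pi, and pi is the quotient by it: a
   surjection for which a function on T is regular as soon as its pullback to G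
   is, so that k[T] is the ring of iota(U)-invariants of k[G]. *)
Record short_exact (k : closedFieldType) (U G T : algGroup k)
    (iota : algHom U G) (pi : algHom G T) : Prop := ShortExact {
  iota_inj : injective iota;
  iota_closed : forall f, regular U f -> exists2 h, regular G h & f = h \o iota;
  pi_surj : forall t, exists g, pi g = t;
  pi_quotient : forall f : T -> k, regular G (f \o pi) -> regular T f;
  exact_mid : forall g, pi g = 1%g <-> exists u, iota u = g }.

Record section (k : closedFieldType) (G T : algGroup k) (pi : algHom G T) :=
  Section_ { section_hom :> algHom T G; sectionK : cancel section_hom pi }.

Section Weights.
Variables (k : closedFieldType) (U G T : algGroup k).
Variables (iota : algHom U G) (pi : algHom G T).
Hypothesis ex : short_exact iota pi.
Variable alpha : section pi.

Lemma conj_act_exists t u : exists u', iota u' = (alpha t * iota u * (alpha t)^-1)%g.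
Proof.
apply/(exact_mid ex); rewrite !gmulfM.
have -> : pi (iota u) = 1%g by apply/(exact_mid ex); exists u.
rewrite mulg1 -gmulfM mulgV.
by apply: (mulgI (pi 1%g)); rewrite -gmulfM !mulg1.
Qed.

(* the action of T on U: iota (t . u) = alpha(t) iota(u) alpha(t)^-1 *)
Definition conj_act (t : T) (u : U) : U := sval (cid (conj_act_exists t u)).

(* The Lie algebra of H: the point derivations of k[H] at 1. A linear form on
   k[H] is coded as a function on all maps H -> k that vanishes off k[H]. *)
Definition lie_alg (H : algGroup k) : set ((H -> k) -> k) :=
  [set D | [/\ forall c f g, regular H f -> regular H g ->
                 D (cst c * f + g) = c * D f + D g,
               forall f g, regular H f -> regular H g ->
                 D (f * g) = f 1%g * D g + D f * g 1%g &
               forall f, ~ regular H f -> D f = 0]].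

(* T acts on the Lie algebra of U by (t . D) f = D (u |-> f (t . u)). *)
Definition lie_weight (m : char T) : set ((U -> k) -> k) :=
  [set D | lie_alg D /\
    forall t f, regular U f -> D (f \o conj_act t) = char_val m t * D f].

Definition lie_weights : set (char T) :=
  [set m | exists2 D, lie_weight m D & D <> 0].

(* tens m 1 is the image of m in M (x) Q. *)
Definition weight_cone : set (char T) :=
  [set m | exists s : seq (rat * char T),
    (forall p, p \in s -> 0 <= p.1 /\ lie_weights p.2) /\
    tens m 1 = \sum_(p <- s) p.1 *: tens p.2 1].

End Weights.

Section Multifiltrations.
Variables (k : closedFieldType) (V : vectType k).

Lemma vspan_exists (A : set V) : exists W : {vspace V},
  (forall v, A v -> v \in W) /\
  forall W' : {vspace V}, (forall v, A v -> v \in W') -> (W <= W')%VS.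
Proof.
suff H n (W : {vspace V}) : (\dim {:V} - \dim W <= n)%N ->
    (forall W' : {vspace V}, (forall v, A v -> v \in W') -> (W <= W')%VS) ->
    exists W : {vspace V}, (forall v, A v -> v \in W) /\
      forall W' : {vspace V}, (forall v, A v -> v \in W') -> (W <= W')%VS.
  by apply: (H _ 0%VS (leqnn _)) => W' _; exact: sub0v.
elim: n W => [|n IH] W Wn Wmin.
  exists W; split=> // v _; move: Wn; rewrite leqn0 subn_eq0 => Wn.
  suff -> : W = fullv by exact: memvf.
  by apply/eqP; rewrite eqEdim subvf.
have [AW|] := pselect (forall v, A v -> v \in W); first by exists W.
move/existsNP => [v /not_implyP[Av /negP vW]].
apply: (IH (W + <[v]>)%VS) => [|W' AW']; last first.
  by rewrite subv_add Wmin // -memvE AW'.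
have lt : (\dim W < \dim (W + <[v]>))%N.
  rewrite ltnNge; apply: contra vW => le.
  have /eqP -> : W == (W + <[v]>)%VS by rewrite eqEdim addvSl.
  by rewrite memvE addvSr.
by rewrite leq_subLR; move: Wn; rewrite leq_subLR => /leq_trans; apply;
   rewrite addnS -addSn leq_add2r.
Qed.

Definition vspan (A : set V) : {vspace V} := sval (cid (vspan_exists A)).

Lemma sub_vspan (A : set V) v : A v -> v \in vspan A.
Proof. exact: (svalP (cid (vspan_exists A))).1. Qed.

Lemma vspan_min (A : set V) (W : {vspace V}) :
  (forall v, A v -> v \in W) -> (vspan A <= W)%VS.
Proof. exact: (svalP (cid (vspan_exists A))).2. Qed.

(* the sum of the W i for i in K *)
Definition vsum (I : Type) (K : set I) (W : I -> {vspace V}) : {vspace V} :=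
  vspan [set v | exists2 i, K i & v \in W i].

Variables (M : zmodType) (C : set M).

Definition pre_le (l m : M) : Prop := C (m - l).

Definition upper (K : set M) : set M := [set l | exists2 m, K m & pre_le m l].

Record multifiltration := Multifiltration {
  mfilt :> M -> {vspace V};
  mfilt_decr : forall l m, pre_le l m -> (mfilt m <= mfilt l)%VS }.

Variable F : multifiltration.

Definition exhaustive : Prop := vsum setT F = fullv.

Definition separated : Prop := forall K : set (set M),
  \bigcap_(A in K) upper A = set0 ->
  forall v, (forall A, K A -> v \in vsum A F) -> v = 0.

Definition regular_mfilt : Prop := forall K1 K2 : set M,
  (vsum K1 F :&: vsum K2 F)%VS = vsum (upper K1 `&` upper K2) F.

End Multifiltrations.

Section WeightMultifiltration.
Variables (k : closedFieldType) (U G T : algGroup k).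
Variables (iota : algHom U G) (pi : algHom G T).
Hypothesis ex : short_exact iota pi.
Variables (V : vectType k) (rho : rep G V) (alpha : section pi).

(* The spanning set is itself a subspace: see mem_weight_space. *)
Definition weight_space (mu : char T) : {vspace V} :=
  vspan [set v | forall t, rho (alpha t) v = char_val mu t *: v].

Lemma mem_weight_space mu v :
  v \in weight_space mu <-> forall t, rho (alpha t) v = char_val mu t *: v.
Proof.
split=> [vW t|vE]; last exact: sub_vspan.
suff : v \in lker (rho (alpha t) - char_val mu t *: \1%VF).
  by rewrite memv_ker add_lfunE opp_lfunE scale_lfunE id_lfunE subr_eq0 => /eqP.
move: v vW; apply/subvP; apply: vspan_min => v vE.
by rewrite memv_ker add_lfunE opp_lfunE scale_lfunE id_lfunE subr_eq0 vE.
Qed.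

Let C := weight_cone ex alpha.

Let C_add m m' : C m -> C m' -> C (m + m').
Proof.
move=> [s [sC sE]] [s' [sC' sE']]; exists (s ++ s'); split.
  by move=> p; rewrite mem_cat => /orP[/sC|/sC'].
by rewrite big_cat /= -sE -sE' tensD.
Qed.

Let F (m : char T) : {vspace V} := vsum [set mu | pre_le C m mu] weight_space.

Let F_decr l m : pre_le C l m -> (F m <= F l)%VS.
Proof.
move=> lm; apply: vspan_min => v [mu mmu vmu]; apply: sub_vspan.
exists mu => //; have : C ((mu - m) + (m - l)) by exact: C_add.
by rewrite addrA subrK.
Qed.

Definition weight_mfilt : multifiltration V C := Multifiltration F_decr.

End WeightMultifiltration.

(* Main.v *)
Require Import Defs.
From mathcomp Require Import all_boot all_order all_algebra.
From mathcomp Require Import boolp classical_sets functions.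
From mathcomp Require Import ring.

(* Two sections alpha and beta differ by elements of iota(U), and by Kolchin's
   theorem iota(U) acts trivially on the graded pieces of a filtration of any
   representation by G-stable subspaces. Hence a nonzero subquotient Y / X of a
   representation of G has the same weights for alpha(T) and beta(T); this
   replaces the conjugacy of maximal tori. Applied to finite dimensional
   G-stable subspaces of k[U], modulo constants and m^2 (m the maximal ideal of
   1), it shows that the weights of the Lie algebra, hence the cone C, do not
   depend on the section. Applied to F_alpha + F_beta modulo F_alpha it gives
   F_alpha = F_beta, once these subspaces are known to be G-stable.

   For the stability one needs that a matrix coefficient of U whose weight lies
   outside C vanishes. A weight vector of k[U] with weight outside C lies in m^2,
   since m / m^2 is dual to the Lie algebra; in a product one of the factors
   again has weight outside C, so the ideal Q generated by all these vectors
   satisfies Q = m Q. By Nakayama Q vanishes near 1, so the stabilizer of F in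
   the connected group iota(U) is open and closed. *)

Set Implicit Arguments.
Unset Strict Implicit.
Unset Printing Implicit Defensive.

Import GRing.Theory.

Local Open Scope classical_set_scope.
Local Open Scope ring_scope.

(** * Algebras of functions and their tensor products *)

Section Subalgebras.
Variables (k : closedFieldType) (X : Type) (B : set (X -> k)).
Hypothesis Bsub : subalg B.

Lemma subalgC c : B (fun=> c).
Proof. by have [BC _ _] := Bsub; exact: BC. Qed.

Lemma subalgD f g : B f -> B g -> B (fun x => f x + g x).
Proof. by have [_ BD _] := Bsub; exact: BD. Qed.

Lemma subalgM f g : B f -> B g -> B (fun x => f x * g x).
Proof. by have [_ _ BM] := Bsub; exact: BM. Qed.

Lemma subalgZ c f : B f -> B (fun x => c * f x).
Proof. by apply: subalgM; exact: subalgC. Qed.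

Lemma subalgB f g : B f -> B g -> B (fun x => f x - g x).
Proof.
move=> Bf Bg; under eq_fun do rewrite -mulN1r.
by apply: subalgD => //; exact: subalgZ.
Qed.

Lemma subalg_sum I (r : seq I) (P : pred I) (F : I -> X -> k) :
  (forall i, P i -> B (F i)) -> B (fun x => \sum_(i <- r | P i) F i x).
Proof.
move=> BF; elim: r => [|i r IH].
  by rewrite (_ : (fun x => _) = cst 0); [exact: subalgC|apply: funext => x; rewrite big_nil].
have -> : (fun x => \sum_(j <- i :: r | P j) F j x) = fun x =>
    if P i then F i x + \sum_(j <- r | P j) F j x else \sum_(j <- r | P j) F j x.
  by apply/funext => x; rewrite big_cons.
by case: (boolP (P i)) => // Pi; apply: subalgD => //; exact: BF.
Qed.

Lemma subalg_prod I (r : seq I) (P : pred I) (F : I -> X -> k) :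
  (forall i, P i -> B (F i)) -> B (fun x => \prod_(i <- r | P i) F i x).
Proof.
move=> BF; elim: r => [|i r IH].
  by rewrite (_ : (fun x => _) = cst 1); [exact: subalgC|apply: funext => x; rewrite big_nil].
have -> : (fun x => \prod_(j <- i :: r | P j) F j x) = fun x =>
    if P i then F i x * \prod_(j <- r | P j) F j x else \prod_(j <- r | P j) F j x.
  by apply/funext => x; rewrite big_cons.
by case: (boolP (P i)) => // Pi; apply: subalgM => //; exact: BF.
Qed.

Lemma subalg_det n (M : 'I_n -> 'I_n -> X -> k) :
  (forall i j, B (M i j)) -> B (fun x => \det (\matrix_(i, j) M i j x)).
Proof.
move=> BM; apply: subalg_sum => s _; apply: subalgZ; apply: subalg_prod => i _.
by under eq_fun do rewrite mxE.
Qed.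

End Subalgebras.

Lemma regular_subalg (k : closedFieldType) (G : algGroup k) :
  subalg (regular G).
Proof.
by have [m [s ->]] := affine_fingen (algGroup_affine G); exact: alg_gen_subalg.
Qed.
#[local] Hint Resolve regular_subalg : core.

(** Finite sums of products of a function of [x] and a function of [y] form a subalgebra, and it
    contains both families of generators. *)
Lemma regular_prod_sum (k : closedFieldType) (X Y : Type)
    (B : set (X -> k)) (B' : set (Y -> k)) h :
  subalg B -> subalg B' -> regular_prod B B' h ->
  exists n (p : 'I_n -> X -> k) (q : 'I_n -> Y -> k),
    [/\ forall i, B (p i), forall i, B' (q i) &
        forall x y, h (x, y) = \sum_i p i x * q i y].
Proof.
move=> sB sB'; pose H : set (X * Y -> k) := [set h | exists s : seq ((X -> k) * (Y -> k)),
  (forall p, p \in s -> B p.1 /\ B' p.2) /\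
  forall x y, h (x, y) = \sum_(p <- s) p.1 x * p.2 y].
suff HB : regular_prod B B' `<=` H.
  move=> /HB [s [sBB' sE]].
  exists (size s), (fun i => (tnth (in_tuple s) i).1), (fun i => (tnth (in_tuple s) i).2).
  split=> [i|i|x y]; try by have [] := sBB' _ (mem_tnth i (in_tuple s)).
  by rewrite sE big_tnth.
apply: alg_gen_min.
  split=> [c|f g [s [sB1 sE]] [s' [sB1' sE']]|f g [s [sB1 sE]] [s' [sB1' sE']]].
  - exists [:: ((fun=> c), (fun=> 1))]; split=> [p|x y].
      by rewrite inE => /eqP-> /=; split; exact: subalgC.
    by rewrite big_seq1 /= mulr1.
  - exists (s ++ s'); split=> [p|x y].
      by rewrite mem_cat => /orP[/sB1|/sB1'].
    by rewrite big_cat /= -sE -sE'.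
  - exists [seq ((fun x => p.1 x * q.1 x), (fun y => p.2 y * q.2 y)) | p <- s, q <- s'].
    split=> [_ /allpairsP[[p q] /= [/sB1[? ?] /sB1'[? ?] ->]]|x y] /=.
      by split; exact: subalgM.
    rewrite big_allpairs_dep -[LHS]/(f (x, y) * g (x, y)) sE sE' mulr_suml /=.
    apply: eq_bigr => p _; rewrite mulr_sumr /=.
    by apply: eq_bigr => q _; rewrite mulrACA.
move=> _ [[f Bf ->]|[f Bf ->]].
  exists [:: (f, (fun=> 1))]; split=> [p|x y].
    by rewrite inE => /eqP-> /=; split => //; exact: subalgC.
  by rewrite big_seq1 /= mulr1.
exists [:: ((fun=> 1), f)]; split=> [p|x y].
  by rewrite inE => /eqP-> /=; split => //; exact: subalgC.
by rewrite big_seq1 /= mul1r.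
Qed.

(** * Characters, their separation and their linear span *)

Section CharacterValues.
Variables (k : closedFieldType) (T : algGroup k).
Implicit Types (x y : char T) (s t : T).

Lemma char_valM x s t : char_val x (s * t)%g = char_val x s * char_val x t.
Proof. by rewrite /char_val gmulfM. Qed.

Lemma char_val_neq0 x t : char_val x t != 0.
Proof. exact: Gm_neq0. Qed.

Lemma char_val1 x : char_val x 1%g = 1.
Proof.
apply: (mulfI (char_val_neq0 x 1%g)).
by rewrite -char_valM mulg1 mulr1.
Qed.

Lemma char_valV x t : char_val x t^-1%g = (char_val x t)^-1.
Proof.
apply: (mulfI (char_val_neq0 x t)).
by rewrite -char_valM mulgV char_val1 mulfV ?char_val_neq0.
Qed.

Lemma char_val0 t : char_val (0 : char T) t = 1. Proof. by []. Qed.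

Lemma char_valD x y t : char_val (x + y) t = char_val x t * char_val y t.
Proof. by []. Qed.

Lemma char_valN x t : char_val (- x) t = (char_val x t)^-1.
Proof. by []. Qed.

Lemma char_neqP x y : x != y -> exists t, char_val x t != char_val y t.
Proof.
move=> /eqP xy; apply: contrapT => h; apply: xy; apply: charP => t.
by apply/eqP; apply: contra_notT h => h; exists t.
Qed.

(* s is an element of the group algebra of T; the characters are separated by
   products of the elements (t - y t) / (x t - y t). *)
Lemma char_proj (S : seq (char T)) x : exists s : seq (k * T),
  \sum_(p <- s) p.1 * char_val x p.2 = 1 /\
  forall y, y \in S -> y != x -> \sum_(p <- s) p.1 * char_val y p.2 = 0.
Proof.
elim: S => [|z S [s [sx sS]]].
  by exists [:: (1, 1%g)]; split=> //; rewrite big_seq1 mul1r char_val1.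
have [->|zx] := eqVneq z x.
  exists s; split=> // y; rewrite inE => /orP[/eqP->|/sS //].
  by rewrite eqxx.
have [t tP] := char_neqP zx.
have d0 : char_val x t - char_val z t != 0 by rewrite subr_eq0 eq_sym.
pose d := (char_val x t - char_val z t)^-1.
pose s' := [:: (d, t); (- char_val z t * d, 1%g)].
have s'E y : \sum_(p <- s') p.1 * char_val y p.2 = (char_val y t - char_val z t) * d.
  by rewrite big_cons big_seq1 /= char_val1 mulr1 mulrBl mulNr [d * _]mulrC.
have ME y : \sum_(p <- [seq (p.1 * q.1, (p.2 * q.2)%g) | p <- s, q <- s'])
      p.1 * char_val y p.2 =
    (\sum_(p <- s) p.1 * char_val y p.2) * ((char_val y t - char_val z t) * d).
  rewrite big_allpairs_dep -s'E mulr_suml /=; apply: eq_bigr => p _.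
  rewrite mulr_sumr; apply: eq_bigr => q _ /=.
  by rewrite char_valM mulrACA.
exists [seq (p.1 * q.1, (p.2 * q.2)%g) | p <- s, q <- s'].
split=> [|y]; rewrite ME; first by rewrite sx mul1r mulfV.
rewrite inE => /orP[/eqP-> _|yS yx]; first by rewrite subrr mul0r mulr0.
by rewrite sS // mul0r.
Qed.

Definition char_span (S : seq (char T)) : set (T -> k) :=
  [set f | exists s : seq (k * char T), (forall p, p \in s -> p.2 \in S) /\
     forall t, f t = \sum_(p <- s) p.1 * char_val p.2 t].

Lemma char_spanW (S S' : seq (char T)) : {subset S <= S'} ->
  char_span S `<=` char_span S'.
Proof. by move=> SS' f [s [sS sE]]; exists s; split=> // p /sS /SS'. Qed.

Lemma char_spanD S f g : char_span S f -> char_span S g ->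
  char_span S (fun t => f t + g t).
Proof.
move=> [s [sS sE]] [s' [sS' sE']]; exists (s ++ s'); split=> [p|t].
  by rewrite mem_cat => /orP[/sS|/sS'].
by rewrite big_cat /= sE sE'.
Qed.

Lemma char_spanZ S c f : char_span S f -> char_span S (fun t => c * f t).
Proof.
move=> [s [sS sE]]; exists [seq (c * p.1, p.2) | p <- s]; split=> [p|t].
  by move=> /mapP[q qs ->] /=; exact: sS.
rewrite big_map sE mulr_sumr /=.
by apply: eq_bigr => p _; rewrite mulrA.
Qed.

Lemma char_span_sum S n (F : 'I_n -> T -> k) : (forall i, char_span S (F i)) ->
  char_span S (fun t => \sum_i F i t).
Proof.
move=> SF; elim: (index_enum _) => [|i r IH].
  by exists [::]; split=> // t; rewrite !big_nil.
have [s [sS sE]] := char_spanD (SF i) IH.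
by exists s; split=> // t; rewrite big_cons -sE.
Qed.

(** The list [S] has to grow: a product of combinations of characters is a combination of sums
    [x + y] in the additive notation for characters. *)
Lemma char_span_subalg : subalg [set f | exists S, char_span S f].
Proof.
split=> [c|f g [S Sf] [S' Sg]|f g [S [s [sS sE]]] [S' [s' [sS' sE']]]].
- exists [:: 0], [:: (c, 0)]; split=> [p|t]; first by rewrite inE => /eqP->; rewrite mem_head.
  by rewrite big_seq1 char_val0 mulr1.
- exists (S ++ S'); apply: char_spanD.
    by apply: char_spanW Sf => x xS; rewrite mem_cat xS.
  by apply: char_spanW Sg => x xS; rewrite mem_cat xS orbT.
- exists [seq p.2 + q.2 | p <- s, q <- s'].
  exists [seq (p.1 * q.1, p.2 + q.2) | p <- s, q <- s']; split=> [p|t].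
    move=> /allpairsP[[p1 p2] [/= ps qs ->]] /=; apply/allpairsP.
    by exists (p1, p2).
  rewrite big_allpairs_dep /= -[LHS]/(f t * g t) sE sE' mulr_suml /=.
  apply: eq_bigr => p _; rewrite mulr_sumr /=.
  by apply: eq_bigr => q _; rewrite char_valD mulrACA.
Qed.

(** Transported to a power of Gm, the algebra k[T] is generated by the coordinates and their
    inverses. Each of these is a character [x] or its opposite [- x], so [char_span_subalg]
    suffices. *)
Lemma torus_char_span (T_torus : torus T) f : regular T f -> exists S, char_span S f.
Proof.
have [n [phi [psi [phiK psiK]]]] := T_torus => Tf.
pose H : set (T -> k) := [set f | exists S, char_span S f].
have -> : f = (f \o psi) \o phi by apply: funext => t /=; rewrite phiK.
move: (f \o psi) (alg_hom_regular psi Tf).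
apply: (alg_gen_min (subalg_comp phi char_span_subalg)) => _ [i [g Gg ->]].
pose u (t : T) : Gm k := (phi t : {ffun 'I_n -> Gm k}) i.
have uM : {morph u : x y / (x * y)%g}.
  by move=> x y; rewrite /u gmulfM ffunE.
have ur g' : regular (Gm k) g' -> regular T (g' \o u).
  by move=> Gg'; exact: (alg_hom_regular phi (pow_regular_coord i Gg')).
pose x := char_build uM (ur _ (@Gm_regular_val k)) (ur _ (@Gm_regular_inv k)).
suff : H (g \o u) by [].
move: g Gg; apply: (Gm_regular_min (subalg_comp u char_span_subalg)).
  exists [:: x], [:: (1, x)]; split=> [p|t]; first by rewrite inE => /eqP->; rewrite mem_head.
  by rewrite big_seq1 mul1r.
exists [:: - x], [:: (1, - x)]; split=> [p|t]; first by rewrite inE => /eqP->; rewrite mem_head.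
by rewrite big_seq1 mul1r.
Qed.

End CharacterValues.

(** * Weight projectors *)

Section Spans.
Variables (k : closedFieldType) (V : vectType k).

(** Vectors of [A] are adjoined while one lies outside the current span; the codimension bounds the
    number of rounds. *)
Lemma vspan_seq (A : set V) :
  exists X : seq V, (forall v, v \in X -> A v) /\ vspan A = <<X>>%VS.
Proof.
suff H n (X : seq V) : (\dim {:V} - \dim <<X>> <= n)%N ->
    (forall v, v \in X -> A v) ->
    exists X : seq V, (forall v, v \in X -> A v) /\ forall v, A v -> v \in <<X>>%VS.
  have [//|X [XA AX]] := H _ [::] (leqnn _); exists X; split=> //.
  apply/eqP; rewrite eqEsubv vspan_min //=.
  by apply/span_subvP => v vX; apply: sub_vspan; exact: XA.
elim: n X => [|n IH] X Xn XA.
  exists X; split=> // v _; move: Xn; rewrite leqn0 subn_eq0 => Xn.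
  suff -> : <<X>>%VS = fullv by exact: memvf.
  by apply/eqP; rewrite eqEdim subvf.
have [AX|] := pselect (forall v, A v -> v \in <<X>>%VS); first by exists X.
move=> /existsNP[v /not_implyP[Av /negP vX]].
apply: (IH (v :: X)) => [|w]; last by rewrite inE => /orP[/eqP->|/XA].
have lt : (\dim <<X>> < \dim <<v :: X>>)%N.
  rewrite span_cons ltnNge; apply: contra vX => le.
  have /eqP -> : <<X>>%VS == (<[v]> + <<X>>)%VS by rewrite eqEdim addvSr.
  by rewrite memvE addvSl.
rewrite leq_subLR; move: Xn; rewrite leq_subLR => /leq_trans; apply.
by rewrite addnS -addSn leq_add2r.
Qed.

(** This turns a predicate closed under linear combinations into a subspace, so that dimensions and
    stability can be discussed for it. *)
Lemma mem_vspan_closed (Z : set V) : Z 0 ->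
  (forall a u v, Z u -> Z v -> Z (a *: u + v)) -> forall v, v \in vspan Z <-> Z v.
Proof.
move=> Z0 ZD v; split; last exact: sub_vspan.
have [X [XZ ->]] := vspan_seq Z; rewrite -[X]/(tval (in_tuple X)) => /coord_span ->.
elim/big_ind: _ => // [u w Zu Zw|i _].
  by rewrite -[u]scale1r; exact: ZD.
rewrite -[_ *: _]addr0; apply: ZD => //.
by apply: XZ; exact: mem_nth.
Qed.

Lemma coord_vbasis_inj (v w : V) :
  (forall i, coord (vbasis fullv) i v = coord (vbasis fullv) i w) -> v = w.
Proof.
move=> E; rewrite (coord_vbasis (memvf v)) (coord_vbasis (memvf w)).
by apply: eq_bigr => i _; rewrite E.
Qed.

End Spans.

Section CompositeRepresentation.
Variables (k : closedFieldType) (G H : algGroup k) (V : vectType k).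
Variables (rho : rep H V) (a : algHom G H).

Lemma alg_hom1 : a 1%g = 1%g.
Proof. by apply: (mulgI (a 1%g)); rewrite -gmulfM !mulg1. Qed.

Lemma alg_homV x : a x^-1%g = (a x)^-1%g.
Proof. by apply: (mulgI (a x)); rewrite -gmulfM !mulgV alg_hom1. Qed.

Let act1 : rho (a 1%g) = \1%VF.
Proof. by rewrite alg_hom1 rep_act1. Qed.

Let actM g h : rho (a (g * h)%g) = (rho (a g) \o rho (a h))%VF.
Proof. by rewrite gmulfM rep_actM. Qed.

Let act_regular v (l : 'Hom(V, k^o)) : regular G (fun g => l (rho (a g) v)).
Proof. exact: (alg_hom_regular a (rep_regular rho v l)). Qed.

Definition rep_comp : rep G V := Rep act1 actM act_regular.

End CompositeRepresentation.

Lemma rep_actMv (k : closedFieldType) (G : algGroup k) (V : vectType k)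
  (rho : rep G V) g h v : rho (g * h)%g v = rho g (rho h v).
Proof. by rewrite rep_actM comp_lfunE. Qed.

Section TorusRepresentations.
Variables (k : closedFieldType) (T : algGroup k) (V : vectType k).
Variable sigma : rep T V.
Implicit Types (x y : char T) (v : V).

Definition rep_weight x v := forall t, sigma t v = char_val x t *: v.

(** The projectors are indexed by all characters, so that no question arises whether [x] is a
    weight; only the decomposition of a vector refers to the finite list [S]. The last field
    reflects that projectors are linear combinations of operators of [T]. *)
Record weight_proj (S : seq (char T)) (e : char T -> 'End(V)) : Prop := WeightProj {
  weight_proj_weight : forall x v, rep_weight x (e x v);
  weight_proj_sum : forall v, v = \sum_(x <- S) e x v;
  weight_proj_id : forall x v, rep_weight x v -> e x v = v;
  weight_proj_ort : forall x y v, rep_weight x v -> x != y -> e y v = 0;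
  weight_proj_stable : forall W : {vspace V},
    (forall t v, v \in W -> sigma t v \in W) ->
    forall x v, v \in W -> e x v \in W }.

(** The element [s] of the group algebra reads off the coefficient of [x] in the combination [r]. It
    is a sum because [r] may list a character several times. *)
Lemma sum_filter_char_span (S : seq (char T)) (r : seq (k * char T)) (s : seq (k * T)) x :
  (forall p, p \in r -> p.2 \in S) ->
  \sum_(p <- s) p.1 * char_val x p.2 = 1 ->
  (forall y, y \in S -> y != x -> \sum_(p <- s) p.1 * char_val y p.2 = 0) ->
  \sum_(p <- s) p.1 * (\sum_(q <- r) q.1 * char_val q.2 p.2) =
    \sum_(q <- r | q.2 == x) q.1.
Proof.
move=> rS s1 s0; under eq_bigr do rewrite mulr_sumr.
rewrite exchange_big [RHS]big_mkcond /= [LHS]big_seq [RHS]big_seq.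
apply: eq_bigr => q /rS qS; under eq_bigr do rewrite mulrCA.
rewrite -mulr_sumr; have [->|qx] := eqVneq; first by rewrite s1 mulr1.
by rewrite s0 // mulr0.
Qed.

(** Finitely many characters [S0] occur in the matrix coefficients. The projector [e x] is the
    operator of the group algebra element that [char_proj] attaches to [x] and [S0]. *)
Lemma torus_weight_proj : torus T -> exists S e, weight_proj S e.
Proof.
move=> T_torus; pose b := vbasis {:V}; pose l i : 'Hom(V, k^o) := linfun (coord b i : V -> k^o).
have lE i v : l i v = coord b i v by rewrite lfunE.
have l_inj v w : (forall i, l i v = l i w) -> v = w.
  by move=> E; apply: coord_vbasis_inj => i; rewrite -!lE.
have /choice[S SP] (p : 'I_(\dim {:V}) * 'I_(\dim {:V})) :
    exists S, char_span S (fun t => l p.1 (sigma t b`_p.2)).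
  by apply: torus_char_span => //; exact: rep_regular.
pose S0 := undup (flatten [seq S p | p <- enum {: 'I_(\dim {:V}) * 'I_(\dim {:V})}]).
have span0 i v : char_span S0 (fun t => l i (sigma t v)).
  rewrite (coord_vbasis (memvf v)).
  under eq_fun do rewrite !linear_sum.
  apply: char_span_sum => j; under eq_fun do rewrite !linearZ.
  apply: char_spanZ; apply: char_spanW (SP (i, j)) => x xS.
  rewrite mem_undup; apply/flattenP; exists (S (i, j)) => //.
  by apply: map_f; rewrite mem_enum.
have /choice[s sP] := char_proj S0.
pose e x : 'End(V) := if x \in S0 then \sum_(p <- s x) p.1 *: sigma p.2 else 0.
have eE x v i : x \in S0 -> l i (e x v) = \sum_(p <- s x) p.1 * l i (sigma p.2 v).
  move=> xS; rewrite /e xS sum_lfunE linear_sum; apply: eq_bigr => p _.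
  by rewrite scale_lfunE linearZ.
have e_weight x v : rep_weight x (e x v).
  move=> t; have [xS|/negbTE xS] := boolP (x \in S0); last first.
    by rewrite /e xS zero_lfunE linear0 scaler0.
  apply: l_inj => i; have [r [rS rE]] := span0 i v.
  have [s1 s0] := sP x.
  have -> : l i (char_val x t *: e x v) = char_val x t * l i (e x v) by rewrite linearZ.
  rewrite eE //; under [in RHS]eq_bigr do rewrite rE.
  rewrite (sum_filter_char_span rS s1 s0) mulr_sumr.
  rewrite {1}/e xS sum_lfunE !linear_sum.
  (* Translation by [t] multiplies the coefficient of each character by its value at [t]; reading
     off the coefficient of [x] then yields the factor [char_val x t]. *)
  have E (p : k * T) : true -> l i (sigma t ((p.1 *: sigma p.2) v)) =
      p.1 * (\sum_(q <- [seq (q.1 * char_val q.2 t, q.2) | q <- r]) q.1 * char_val q.2 p.2).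
    move=> _.
    have -> : l i (sigma t ((p.1 *: sigma p.2) v)) = p.1 * l i (sigma t (sigma p.2 v)).
      by rewrite scale_lfunE !linearZ.
    rewrite -rep_actMv rE big_map; congr (_ * _).
    by apply: eq_bigr => q _; rewrite char_valM mulrA.
  rewrite (eq_bigr _ E) (sum_filter_char_span _ s1 s0); last first.
    by move=> _ /mapP[q /rS qS ->].
  by rewrite big_map /=; apply: eq_bigr => q /eqP->; rewrite mulrC.
have e_stable (W : {vspace V}) : (forall t v, v \in W -> sigma t v \in W) ->
    forall x v, v \in W -> e x v \in W.
  move=> WT x v vW; rewrite /e; case: ifP => _; last by rewrite zero_lfunE mem0v.
  rewrite sum_lfunE; apply: memv_suml => p _.
  by rewrite scale_lfunE; apply: memvZ; exact: WT.
have e_sum v : v = \sum_(x <- S0) e x v.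
  apply: l_inj => i; rewrite linear_sum.
  have [r [rS rE]] := span0 i v.
  have E x : x \in S0 -> l i (e x v) = \sum_(q <- r) if q.2 == x then q.1 else 0.
    move=> xS; have [s1 s0] := sP x; rewrite eE //.
    under eq_bigr do rewrite rE.
    by rewrite (sum_filter_char_span rS s1 s0) big_mkcond.
  rewrite big_seq (eq_bigr _ E) -big_seq exchange_big /=.
  (* At the identity every character is 1, so [l i v] is the sum of all coefficients of [r], which
     the right hand side groups by character. *)
  rewrite -[v in LHS](id_lfunE v) -(rep_act1 sigma) rE big_seq [RHS]big_seq.
  apply: eq_bigr => q qr; rewrite char_val1 mulr1 (bigD1_seq q.2) ?undup_uniq ?rS //=.
  rewrite eqxx big1 ?addr0 // => x; rewrite eq_sym => /negbTE->//.
have e_ort x y v : rep_weight x v -> x != y -> e y v = 0.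
  move=> vx xy; have [c cE] : exists c, e y v = c *: v.
    rewrite /e; case: ifP => _; last by exists 0; rewrite zero_lfunE scale0r.
    exists (\sum_(p <- s y) p.1 * char_val x p.2); rewrite sum_lfunE scaler_suml.
    by apply: eq_bigr => p _; rewrite scale_lfunE vx scalerA.
  have [t tP] := char_neqP xy; apply/eqP.
  have := e_weight y v t; rewrite cE linearZ /= vx scalerA mulrC -scalerA -cE => /eqP.
  by rewrite -subr_eq0 -scalerBl scaler_eq0 subr_eq0 (negbTE tP).
exists S0, e; split=> // x v vx.
rewrite [in RHS](e_sum v); have [xS|xS] := boolP (x \in S0).
  rewrite (bigD1_seq x) ?undup_uniq //= big1 ?addr0 // => y yx.
  by apply: e_ort vx _; rewrite eq_sym.
have vE : v = 0.
  rewrite (e_sum v) big_seq big1 // => y yS; apply: e_ort vx _.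
  by apply: contraNneq xS => ->.
by rewrite -e_sum vE linear0.
Qed.

End TorusRepresentations.

(** * The multifiltration of a section *)

Section WeightSums.
Variables (k : closedFieldType) (U G T : algGroup k).
Variables (iota : algHom U G) (pi : algHom G T).
Hypothesis ex : short_exact iota pi.
Variables (V : vectType k) (rho : rep G V) (alpha : section pi).
Variables (S : seq (char T)) (e : char T -> 'End(V)).
Hypothesis eP : weight_proj (rep_comp rho alpha) S e.

Let C := weight_cone ex alpha.
Let F := weight_mfilt ex rho alpha.

Lemma weight_cone0 : C 0.
Proof.
exists [::]; split=> //; rewrite big_nil.
by apply: (addIr (tens 0 1)); rewrite -tensD !add0r.
Qed.

Lemma weight_coneD m m' : C m -> C m' -> C (m + m').
Proof.
move=> [s [sC sE]] [s' [sC' sE']]; exists (s ++ s'); split.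
  by move=> p; rewrite mem_cat => /orP[/sC|/sC'].
by rewrite big_cat /= -sE -sE' tensD.
Qed.

Lemma weight_cone_weight m : lie_weights ex alpha m -> C m.
Proof.
move=> mR; exists [:: (1, m)]; split=> [p|]; first by rewrite inE => /eqP->.
by rewrite big_seq1 scale1r.
Qed.

Lemma pre_le_refl m : pre_le C m m.
Proof. by rewrite /pre_le subrr; exact: weight_cone0. Qed.

Lemma pre_le_trans l m n : pre_le C l m -> pre_le C m n -> pre_le C l n.
Proof.
move=> lm mn; have : C ((n - m) + (m - l)) by exact: weight_coneD.
by rewrite addrA subrK.
Qed.

Lemma mem_weight_sum (P : set (char T)) v :
  v \in vsum P (weight_space rho alpha) <-> forall x, ~ P x -> e x v = 0.
Proof.
split=> [vP x Px|E].
  apply/eqP; rewrite -memv_ker; move: v vP; apply/subvP; apply: vspan_min.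
  move=> v [y Py /mem_weight_space yv]; rewrite memv_ker; apply/eqP.
  apply: (weight_proj_ort eP yv); apply/eqP => yx.
  by apply: Px; rewrite -yx.
rewrite (weight_proj_sum eP v); apply: memv_suml => x _.
have [Px|Px] := pselect (P x); last by rewrite E // mem0v.
apply: sub_vspan; exists x => //.
by apply/mem_weight_space; exact: (weight_proj_weight eP).
Qed.

Lemma mem_weight_mfilt m v :
  v \in F m <-> forall x, ~ pre_le C m x -> e x v = 0.
Proof. exact: mem_weight_sum. Qed.

Lemma vsum_weight_mfilt (K : set (char T)) :
  vsum K F = vsum (upper C K) (weight_space rho alpha).
Proof.
apply/eqP; rewrite eqEsubv; apply/andP; split; apply: vspan_min => v.
  move=> [m Km /mem_weight_mfilt vm]; apply/mem_weight_sum => x Kx.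
  by apply: vm => mx; apply: Kx; exists m.
move=> [x [m Km mx] vx]; apply: sub_vspan; exists m => //.
by apply: sub_vspan; exists x.
Qed.

(** With this criterion the three properties of [F] become statements about upper sets of
    characters. *)
Lemma mem_vsum_weight_mfilt (K : set (char T)) v :
  v \in vsum K F <-> forall x, ~ upper C K x -> e x v = 0.
Proof. by rewrite vsum_weight_mfilt mem_weight_sum. Qed.

Lemma weight_mfilt_exhaustive : exhaustive F.
Proof.
apply/eqP; rewrite eqEsubv subvf; apply/subvP => v _.
apply/mem_vsum_weight_mfilt => x []; exists x => //; exact: pre_le_refl.
Qed.

Lemma weight_mfilt_separated : separated F.
Proof.
move=> K K0 v vK; rewrite (weight_proj_sum eP v) big1 // => x _.
apply: contrapT => ex0; suff : set0 x by [].
rewrite -K0 => A KA; apply: contrapT => Ax; apply: ex0.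
by move/vK: KA => /mem_vsum_weight_mfilt; exact.
Qed.

(** Both sides are cut out by the same characters, since the intersection of two upper sets is its
    own upper set. *)
Lemma weight_mfilt_regular : regular_mfilt F.
Proof.
move=> K1 K2; apply/vspaceP => v; rewrite memv_cap; apply/andP/idP.
  move=> [/mem_vsum_weight_mfilt v1 /mem_vsum_weight_mfilt v2].
  apply/mem_vsum_weight_mfilt => x Kx.
  have [K1x|] := pselect (upper C K1 x); last exact: v1.
  have [K2x|] := pselect (upper C K2 x); last exact: v2.
  by exfalso; apply: Kx; exists x => //; exact: pre_le_refl.
move=> /mem_vsum_weight_mfilt vK; split; apply/mem_vsum_weight_mfilt => x Kx;
  apply: vK => -[y [[m1 K1m m1y] [m2 K2m m2y]] yx]; apply: Kx.
  by exists m1 => //; exact: pre_le_trans yx.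
by exists m2 => //; exact: pre_le_trans yx.
Qed.

End WeightSums.

(** * Unipotent groups *)

(** Induction on the dimension of [Y]. If some [g] moves a vector of [Y] modulo [X], then [Y] is
    replaced by the vectors that [g] fixes modulo [X]; they form a smaller subspace, stable under
    [H] because of commutation modulo [X]. *)
Lemma commuting_unipotent_fixed (k : fieldType) (V : vectType k)
    (H : set 'End(V)) (X Y : {vspace V}) :
  ~~ (Y <= X)%VS ->
  (forall h v, H h -> v \in X -> h v \in X) ->
  (forall h v, H h -> v \in Y -> h v \in Y) ->
  (forall h, H h -> exists n, forall v, iter n (fun w => h w - w) v = 0) ->
  (forall g h v, H g -> H h -> v \in Y -> g (h v) - h (g v) \in X) ->
  exists v, [/\ v \in Y, v \notin X & forall h, H h -> h v - v \in X].
Proof.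
move=> + XH + unip; have [n] := ubnP (\dim Y); elim: n Y => // n IH Y Yn YX YH comm.
have [[g [w [Hg wY wX]]]|] :=
    pselect (exists g w, [/\ H g, w \in Y & g w - w \notin X]); last first.
  move=> fixed; have /subvPn[v vY vX] := YX; exists v; split=> // h Hh.
  by apply: contra_notT fixed => hv; exists h, v.
pose Y' := (Y :&: (g - \1%VF) @^-1: X)%VS.
have Y'E v : (v \in Y') = (v \in Y) && (g v - v \in X).
  by rewrite memv_cap -memv_preim add_lfunE opp_lfunE id_lfunE.
have [||h v Hh|g' h v Hg' Hh|v []] := IH Y'.
- have lt : (\dim Y' < \dim Y)%N.
    rewrite ltnNge; apply: contra wX => le.
    have YE : Y' == Y by rewrite eqEdim capvSl.
    by move: wY; rewrite -(eqP YE) Y'E => /andP[].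
  by rewrite ltnS in Yn; exact: leq_trans lt Yn.
(* Iterating [g - 1] on a vector outside [X] ends at 0; the last iterate before entering [X] belongs
   to [Y']. *)
- have [v vY vX] := subvPn YX; have [m] := unip g Hg.
  move/(_ v); elim: m v vY vX => [v vY + /= v0|m IHm v vY vX]; first by rewrite v0 mem0v.
  rewrite iterSr => mv; have [gvX|gvX] := boolP (g v - v \in X).
    by apply/subvPn; exists v; rewrite ?Y'E ?vY.
  by apply: IHm gvX mv; rewrite rpredB // YH.
- rewrite !Y'E => /andP[vY gv]; rewrite YH //=.
  have -> : g (h v) - h v = (g (h v) - h (g v)) + h (g v - v).
    by rewrite linearB /= addrA subrK.
  by rewrite rpredD ?comm // XH.
- by rewrite Y'E => /andP[vY _]; exact: comm.
- by rewrite Y'E => /andP[vY _] vX vH; exists v.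
Qed.

Section SolvableGroups.
Variables (k : closedFieldType) (G : algGroup k).

Lemma derived_series_subgroup n : subgroup (derived_series (G := G) n).
Proof.
case: n => [|n]; first by split.
split=> [A [[A1 _ _] _] //|x y Dx Dy A AS|x Dx A AS].
  by have [[_ AM _] _] := AS; apply: AM; [exact: Dx|exact: Dy].
by have [[_ _ AV] _] := AS; apply: AV; exact: Dx.
Qed.

Lemma derived_series_comm n x y : derived_series (G := G) n x ->
  derived_series n y -> derived_series n.+1 [~ x, y]%g.
Proof. by move=> Dx Dy; apply: sub_gen_smallest; exists x, y. Qed.

Lemma derived_seriesS n : derived_series (G := G) n.+1 `<=` derived_series n.
Proof.
have [D1 DM DV] := derived_series_subgroup n.
apply: smallest_sub => [|_ [x [y [Dx Dy ->]]]]; first exact: derived_series_subgroup.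
by do ?[apply: (DM)|apply: (DV)].
Qed.

(* Kolchin's theorem for Y / X, without forming the quotient. *)
Lemma solvable_unipotent_fixed (V : vectType k) (rho : rep G V) (N : set G)
    (X Y : {vspace V}) :
  solvable G -> subgroup N -> (forall g, N g -> unipotent g) ->
  ~~ (Y <= X)%VS -> (X <= Y)%VS ->
  (forall g v, N g -> v \in X -> rho g v \in X) ->
  (forall g v, N g -> v \in Y -> rho g v \in Y) ->
  exists v, [/\ v \in Y, v \notin X & forall g, N g -> rho g v - v \in X].
Proof.
move=> [n Dn] [N1 NM NV] Nunip YX XsubY XN YN.
(* Climbing the derived series from its trivial term [n] up to term 0, which is the whole group. *)
suff: forall m, (m <= n)%N -> exists v, [/\ v \in Y, v \notin X &
    forall g, derived_series (n - m) g -> N g -> rho g v - v \in X].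
  move=> /(_ n (leqnn n)) [v [vY vX vN]]; exists v; split=> // g Ng.
  by apply: vN => //; rewrite subnn.
elim=> [_|m IH mn].
  have /subvPn[v vY vX] := YX; exists v; split=> // g.
  by rewrite subn0 Dn => -> _; rewrite rep_act1 id_lfunE subrr mem0v.
have {IH} [w [wY wX wD]] := IH (ltnW mn).
move: wD; rewrite -(subnSK mn); set i := (n - m.+1)%N => wD.
have [D1 DM DV] := derived_series_subgroup i.
(* On the vectors fixed modulo [X] by term [i.+1], the elements of [N] in term [i] commute modulo
   [X], since their commutators lie in term [i.+1]. This brings the commuting case to bear. *)
pose Z : set V := [set v | v \in Y /\
  forall g, derived_series i.+1 g -> N g -> rho g v - v \in X].
have ZE v : v \in vspan Z <-> Z v.
  apply: mem_vspan_closed => [|a u v' [uY uD] [vY vD]].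
    by split=> [|g _ _]; [exact: mem0v|rewrite linear0 subrr; exact: mem0v].
  split=> [|g Dg Ng]; first by rewrite rpredD ?rpredZ.
  rewrite linearD linearZ /= opprD addrACA -scalerBr.
  by rewrite rpredD ?rpredZ ?uD ?vD.
have NZ g v : derived_series i g -> N g -> v \in vspan Z -> rho g v \in vspan Z.
  move=> Dg Ng /ZE[vY vD]; apply/ZE; split=> [|h Dh Nh]; first exact: YN.
  have Nc : N [~ h, g]%g by do ?[apply: (NM)|apply: (NV)].
  have Dc : derived_series i.+1 [~ h, g]%g.
    by apply: derived_series_comm => //; exact: derived_seriesS.
  rewrite -rep_actMv commgC -mulgA rep_actMv -linearB /= rep_actMv.
  apply: (XN) => //; have -> : rho h (rho [~ h, g]%g v) - v =
      rho h (rho [~ h, g]%g v - v) + (rho h v - v) by rewrite linearB /= addrA subrK.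
  by rewrite rpredD ?vD //; apply: (XN) => //; exact: vD.
pose H : set 'End(V) := [set f | exists g, [/\ derived_series i g, N g & f = rho g]].
have [|_ v [g [_ Ng ->]]|_ v [g [Dg Ng ->]]|_ [g [_ Ng ->]]|_ _ v [g [Dg Ng ->]] [h [Dh Nh ->]]|v []] :=
  @commuting_unipotent_fixed _ _ H X (vspan Z).
- by apply/subvPn; exists w => //; apply/ZE.
- exact: (XN).
- exact: NZ.
- exact: Nunip.
- move=> /ZE[vY vD].
  have Nc : N [~ g, h]%g by do ?[apply: (NM)|apply: (NV)].
  rewrite -!rep_actMv commgC rep_actMv -linearB; apply: (XN); first exact: NM.
  by apply: vD Nc; exact: derived_series_comm.
- move=> /ZE[vY _] vX vH; exists v; split=> // g Dg Ng.
  by apply: vH; exists g.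
Qed.

End SolvableGroups.

(** * Comparison of two sections *)

Section TwoSections.
Variables (k : closedFieldType) (U G T : algGroup k).
Variables (iota : algHom U G) (pi : algHom G T).
Hypothesis ex : short_exact iota pi.
Hypothesis G_solvable : solvable G.
Hypothesis T_torus : torus T.
Hypothesis N_unipotent : connected_normal_unipotent (range iota).
Variables (V : vectType k) (rho : rep G V).

Lemma ker_pi g : pi g = 1%g -> range iota g.
Proof. by move=> /(exact_mid ex)[u <-]; exists u. Qed.

Lemma section_quotient (alpha : section pi) g :
  range iota (g * (alpha (pi g))^-1)%g.
Proof. by apply: ker_pi; rewrite gmulfM alg_homV sectionK mulgV. Qed.

Lemma weight_proj_comm (sigma : rep T V) S e : weight_proj sigma S e ->
  forall x t v, e x (sigma t v) = char_val x t *: e x v.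
Proof.
move=> eP x t v; rewrite [in LHS](weight_proj_sum eP v) !linear_sum.
rewrite [in RHS](weight_proj_sum eP v) linear_sum scaler_sumr.
apply: eq_bigr => y _; have ey := weight_proj_weight eP y v.
rewrite /= ey linearZ /=; have [->//|yx] := eqVneq y x.
by rewrite (weight_proj_ort eP ey yx) !scaler0.
Qed.

(* Two sections differ by elements of iota(U), which acts trivially on the
   graded pieces of a suitable filtration of Y / X by G-stable subspaces. *)
Lemma weight_transfer (alpha beta : section pi) (X Y : {vspace V}) x v :
  (X <= Y)%VS ->
  (forall g w, w \in X -> rho g w \in X) ->
  (forall g w, w \in Y -> rho g w \in Y) ->
  v \in Y -> v \notin X -> rep_weight (rep_comp rho alpha) x v ->
  exists w, [/\ w \in Y, w \notin X & rep_weight (rep_comp rho beta) x w].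
Proof.
move=> + + GY vY + vx; have [Nsub _ _ Nnormal Nunip] := N_unipotent.
have [n] := ubnP (\dim Y - \dim X); elim: n X => // n IH X Xn XY GX vX.
(* The next layer of the filtration: the preimage of the [iota(U)]-fixed vectors of Y / X. It is
   [G]-stable by normality, and strictly larger than [X] by Kolchin's theorem. *)
pose Z : set V := [set w | w \in Y /\ forall g, range iota g -> rho g w - w \in X].
pose X' := vspan Z; have X'E w : w \in X' <-> Z w.
  apply: mem_vspan_closed => [|a u w' [uY uN] [wY wN]].
    by split=> [|g _]; [exact: mem0v|rewrite linear0 subrr; exact: mem0v].
  split=> [|g Ng]; first by rewrite rpredD ?rpredZ.
  by rewrite linearD linearZ /= opprD addrACA -scalerBr rpredD ?rpredZ ?uN ?wN.
have XX' : (X <= X')%VS.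
  apply/subvP => w wX; apply/X'E; split=> [|g _]; first exact: subvP XY _ wX.
  by rewrite rpredB ?GX.
have X'Y : (X' <= Y)%VS by apply/subvP => w /X'E[].
have GX' g w : w \in X' -> rho g w \in X'.
  move=> /X'E[wY wN]; apply/X'E; split=> [|h Nh]; first exact: GY.
  have -> : rho h (rho g w) = rho g (rho (g^-1 * h * g)%g w).
    by rewrite -!rep_actMv !mulgA mulgV mul1g.
  rewrite -linearB; apply: GX; apply: wN.
  by have := Nnormal g^-1%g h Nh; rewrite invgK.
(* If [v] survives in Y / X', induction applies there. Otherwise [v] is a weight vector of [beta]
   modulo [X], and its projection [e x v] is the required vector. *)
have [vX'|vX'] := boolP (v \in X'); last first.
  have [|w [wY wX' wx]] := IH X' _ X'Y GX' vX'; last first.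
  - by exists w; split=> //; apply: contra wX'; exact: subvP.
  - have YX : ~~ (Y <= X)%VS by apply/subvPn; exists v.
    have [w [wY wX wN]] := solvable_unipotent_fixed G_solvable Nsub Nunip YX XY
      (fun g w _ => GX g w) (fun g w _ => GY g w).
    have lt : (\dim X < \dim X')%N.
      rewrite ltnNge; apply: contra wX => le.
      have XE : X == X' by rewrite eqEdim XX'.
      by rewrite (eqP XE); apply/X'E.
    rewrite ltnS in Xn; apply: leq_trans Xn; apply: ltn_sub2l => //.
    by apply: leq_trans lt _; exact: dimvS.
have [S [e eP]] := torus_weight_proj (rep_comp rho beta) T_torus.
have eX y w : w \in X -> e y w \in X.
  by move=> wX; apply: (weight_proj_stable eP) => // t u; exact: GX.
(* For [y] other than [x], applying [e y] to the vector [beta t v - x(t) v] of [X] gives (y(t) -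
   x(t)) e_y v, and some [t] makes the scalar nonzero. *)
have vE : v - e x v \in X.
  rewrite (weight_proj_sum eP (v - _)); apply: memv_suml => y _; rewrite linearB /=.
  have exv := weight_proj_weight eP x v; have [->|yx] := eqVneq y x.
    by rewrite (weight_proj_id eP exv) subrr mem0v.
  rewrite (weight_proj_ort eP exv) 1?eq_sym // subr0.
  have [t tP] := char_neqP yx.
  suff: (char_val y t - char_val x t) *: e y v \in X.
    by rewrite rpredZeq subr_eq0 (negbTE tP).
  rewrite scalerBl -(weight_proj_comm eP) -linearZ -linearB; apply: eX.
  have [u _ uE] : range iota (beta t * (alpha t)^-1)%g.
    by have := section_quotient alpha (beta t); rewrite sectionK.
  have -> : rep_comp rho beta t v = char_val x t *: rho (iota u) v.
    rewrite -linearZ -vx /= -rep_actMv uE -mulgA mulVg mulg1.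
    by [].
  rewrite -scalerBr; apply: rpredZ; have [_ vN] := (X'E v).1 vX'.
  by apply: vN; exists u.
exists (e x v); split=> [||]; last exact: (weight_proj_weight eP).
  by apply: (weight_proj_stable eP) => // t u; exact: GY.
by apply: contra vX => exX; rewrite -[v](subrK (e x v)) rpredD.
Qed.

(** Suppose (A + B) / A is nonzero. It has a weight [x] for [alpha], necessarily not above [m] as
    all other weights already occur inside [A]. The same weight for [beta] is impossible: [b x]
    kills [B] and preserves [A]. *)
Lemma weight_mfilt_sub (alpha beta : section pi) m :
  weight_cone ex alpha = weight_cone ex beta ->
  (forall g v, v \in weight_mfilt ex rho alpha m -> rho g v \in weight_mfilt ex rho alpha m) ->
  (forall g v, v \in weight_mfilt ex rho beta m -> rho g v \in weight_mfilt ex rho beta m) ->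
  (weight_mfilt ex rho beta m <= weight_mfilt ex rho alpha m)%VS.
Proof.
move=> CE; set A := weight_mfilt ex rho alpha m; set B := weight_mfilt ex rho beta m.
move=> GA GB; have [Sa [a aP]] := torus_weight_proj (rep_comp rho alpha) T_torus.
have [Sb [b bP]] := torus_weight_proj (rep_comp rho beta) T_torus.
apply: contraT => BA; have GAB g v : v \in (A + B)%VS -> rho g v \in (A + B)%VS.
  by move=> /memv_addP[u uA [w wB ->]]; rewrite linearD; apply: memv_add; [exact: GA|exact: GB].
have /subvPn[v vAB vA] : ~~ (A + B <= A)%VS by rewrite subv_add subvv.
have [x xA] : exists x, a x v \notin A.
  apply: contrapT => h; move/negP: vA; apply; rewrite (weight_proj_sum aP v).
  by apply: memv_suml => x _; apply: contrapT => /negP xA; apply: h; exists x.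
have xAB : a x v \in (A + B)%VS.
  by apply: (weight_proj_stable aP) => // t u; exact: GAB.
have mx : ~ pre_le (weight_cone ex beta) m x.
  rewrite -CE => mx; move/negP: xA; apply; apply/(mem_weight_mfilt ex aP) => y my.
  apply: (weight_proj_ort aP (weight_proj_weight aP x v)); apply/eqP => xy.
  by apply: my; rewrite -xy.
have [w [/memv_addP[u uA [w' wB ->]] wA wx]] :=
  weight_transfer beta (addvSl A B) GA GAB xAB xA (weight_proj_weight aP x v).
move/negP: wA; case; rewrite -(weight_proj_id bP wx) linearD /=.
rewrite ((mem_weight_mfilt ex bP m w').1 wB x mx) addr0.
by apply: (weight_proj_stable bP) => // t u'; exact: GA.
Qed.

End TwoSections.

(** * Finite dimensional spaces of functions *)

(** The form is a coordinate of [v - projv W v] that does not vanish at [w]. *)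
Lemma separating_form (k : fieldType) (V : vectType k) (W : {vspace V}) w :
  w \notin W -> exists l : 'Hom(V, k^o), (forall v, v \in W -> l v = 0) /\ l w != 0.
Proof.
move=> wW; pose q : 'End(V) := \1%VF - projv W.
have qE v : q v = v - projv W v by rewrite add_lfunE opp_lfunE id_lfunE.
have [i qi] : exists i, coord (vbasis fullv) i (q w) != 0.
  apply: contrapT => h; move/negP: wW; apply.
  have : q w = 0.
    rewrite (coord_vbasis (memvf (q w))) big1 // => i _.
    suff -> : coord (vbasis fullv) i (q w) = 0 by rewrite scale0r.
    by apply/eqP; apply: contra_notT h => qi; exists i.
  by rewrite qE => /subr0_eq->; exact: memv_proj.
pose c : 'Hom(V, k^o) := linfun (coord (vbasis fullv) i : V -> k^o).
have cE v : c v = coord (vbasis fullv) i v by rewrite lfunE.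
exists (c \o q)%VF; split=> [v vW|]; last by rewrite comp_lfunE cE.
by rewrite comp_lfunE qE projv_id // subrr linear0.
Qed.

Lemma row_formE (k : fieldType) n (l : 'Hom('rV[k]_n, k^o)) v :
  l v = \sum_i v 0 i * l (delta_mx 0 i).
Proof. by rewrite {1}[v]row_sum_delta linear_sum; apply: eq_bigr => i _; rewrite linearZ. Qed.

Section IndependentFunctions.
Variable k : closedFieldType.

Definition lin_indep X n (p : 'I_n -> X -> k) :=
  forall c : 'I_n -> k, (forall x, \sum_i c i * p i x = 0) -> forall i, c i = 0.

(** The rows of values of [p] at the points of [X] span the whole row space, because a linear form
    vanishing on all of them is a linear relation among the functions. *)
Lemma lin_indep_points X n (p : 'I_n -> X -> k) : lin_indep p ->
  forall j, exists s : seq (k * X), forall l, \sum_(r <- s) r.1 * p l r.2 = (l == j)%:R.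
Proof.
move=> pI j; pose Z : set 'rV[k]_n := [set v | exists s : seq (k * X),
  forall l, \sum_(r <- s) r.1 * p l r.2 = v 0 l].
have ZE v : v \in vspan Z <-> Z v.
  apply: mem_vspan_closed => [|a u w [s sE] [s' sE']].
    by exists [::] => l; rewrite big_nil mxE.
  exists ([seq (a * r.1, r.2) | r <- s] ++ s') => l.
  rewrite big_cat big_map /= sE' !mxE -sE mulr_sumr; congr (_ + _).
  by apply: eq_bigr => r _; rewrite mulrA.
suff /ZE[s sE] : delta_mx 0 j \in vspan Z.
  by exists s => l; rewrite sE mxE eqxx.
apply: contraT => /separating_form[l [lZ]]; case/negP; apply/eqP.
apply: (pI (fun i => l (delta_mx 0 i))) => x.
rewrite -[RHS](lZ (\row_i p i x)); last first.
  by apply/ZE; exists [:: (1, x)] => i; rewrite big_seq1 mul1r mxE.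
by rewrite row_formE; apply: eq_bigr => i _; rewrite mxE mulrC.
Qed.

Definition tensor_decomp X Y (B : set (X -> k)) (B' : set (Y -> k))
    (h : X -> Y -> k) n (p : 'I_n -> X -> k) (q : 'I_n -> Y -> k) :=
  [/\ forall i, B (p i), forall i, B' (q i) &
      forall x y, h x y = \sum_i p i x * q i y].

Lemma tensor_decomp_sym X Y B B' h n p q : @tensor_decomp X Y B B' h n p q ->
  tensor_decomp B' B (fun y x => h x y) q p.
Proof.
by move=> [Bp Bq hE]; split=> // y x; rewrite hE; apply: eq_bigr => i _; rewrite mulrC.
Qed.

(** A relation with nonzero coefficient at [i] expresses [p i] through the other functions;
    substituting it changes the [q] and saves one term. *)
Lemma tensor_decomp_reduce X Y B B' h n p q : subalg B' ->
  @tensor_decomp X Y B B' h n p q -> ~ lin_indep p ->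
  exists2 m, (m < n)%N & exists p' q', @tensor_decomp X Y B B' h m p' q'.
Proof.
move=> sB'; case: n p q => [|n] p q [Bp Bq hE] pI.
  by exfalso; apply: pI => c _ [].
have [c [cE [i ci]]] : exists c, (forall x, \sum_i c i * p i x = 0) /\ exists i, c i != 0.
  apply: contrapT => h'; apply: pI => c cE i.
  by apply/eqP; apply: contra_notT h' => ci; exists c; split=> //; exists i.
exists n => //; exists (fun j => p (lift i j)).
exists (fun j y => q (lift i j) y - c (lift i j) / c i * q i y); split=> // [j|x y].
  by apply: subalgB => //; exact: subalgZ.
have piE : p i x = - \sum_j c (lift i j) / c i * p (lift i j) x.
  apply: (mulfI ci); rewrite mulrN mulr_sumr; apply/eqP; rewrite -addr_eq0; apply/eqP.
  rewrite -[RHS](cE x) (bigD1_ord i) //=; congr (_ + _).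
  by apply: eq_bigr => j _; rewrite mulrA mulrCA mulfV // mulr1.
rewrite hE (bigD1_ord i) //= piE mulNr mulr_suml -sumrN -big_split /=.
apply: eq_bigr => j _; rewrite mulrBr addrC; congr (_ - _).
by rewrite [RHS]mulrCA mulrA.
Qed.

Lemma tensor_decomp_indep X Y B B' h n p q : subalg B -> subalg B' ->
  @tensor_decomp X Y B B' h n p q ->
  exists m p' q', [/\ @tensor_decomp X Y B B' h m p' q', lin_indep p' & lin_indep q'].
Proof.
move=> sB sB' H; have [m] := ubnP n; elim: m n p q H => // m IH n p q H nm.
have step : (exists2 m, (m < n)%N & exists p' q', @tensor_decomp X Y B B' h m p' q') ->
    exists m p' q', [/\ @tensor_decomp X Y B B' h m p' q', lin_indep p' & lin_indep q'].
  move=> [n' n'n [p' [q' H']]]; apply: IH H' _.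
  by rewrite ltnS in nm; exact: leq_trans n'n nm.
have [pI|pI] := pselect (lin_indep p); last first.
  by apply: step; exact: tensor_decomp_reduce H pI.
have [qI|qI] := pselect (lin_indep q); last first.
  apply: step; have [n' n'n [p' [q' H']]] := tensor_decomp_reduce sB (tensor_decomp_sym H) qI.
  by exists n' => //; exists q', p'; exact: tensor_decomp_sym H'.
by exists n, p, q.
Qed.

End IndependentFunctions.

Lemma regular_translate (k : closedFieldType) (G : algGroup k) (g : G) f :
  regular G f -> regular G (fun h => f (g * h)%g).
Proof.
move=> Gf; have [n [p [q [_ Gq E]]]] :=
  regular_prod_sum (regular_subalg G) (regular_subalg G) (algGroup_mul Gf).
rewrite (_ : (fun h => _) = fun h => \sum_i p i g * q i h); last first.
  by apply: funext => h; rewrite -E.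
by apply: subalg_sum => // i _; exact: subalgZ.
Qed.

(** * The action of [G] on k[U] by conjugation *)

Section Conjugation.
Variables (k : closedFieldType) (U G T : algGroup k).
Variables (iota : algHom U G) (pi : algHom G T).
Hypothesis ex : short_exact iota pi.

Lemma gconj_exists g u : exists u', iota u' = (g * iota u * g^-1)%g.
Proof.
apply/(exact_mid ex); rewrite !gmulfM.
have -> : pi (iota u) = 1%g by apply/(exact_mid ex); exists u.
by rewrite mulg1 -gmulfM mulgV alg_hom1.
Qed.

Definition gconj g u : U := sval (cid (gconj_exists g u)).

Lemma gconjE g u : iota (gconj g u) = (g * iota u * g^-1)%g.
Proof. exact: svalP (cid (gconj_exists g u)). Qed.

Lemma conj_act_gconj (alpha : section pi) t : conj_act ex alpha t = gconj (alpha t).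
Proof.
apply: funext => u; apply: (iota_inj ex); rewrite gconjE.
exact: svalP (cid (conj_act_exists ex alpha t u)).
Qed.

Lemma gconjM g h u : gconj (g * h)%g u = gconj g (gconj h u).
Proof. by apply: (iota_inj ex); rewrite !gconjE invgM !mulgA. Qed.

Lemma gconj1 g : gconj g 1%g = 1%g.
Proof. by apply: (iota_inj ex); rewrite gconjE alg_hom1 mulg1 mulgV. Qed.

Lemma gconj1g u : gconj 1%g u = u.
Proof. by apply: (iota_inj ex); rewrite gconjE invg1 mulg1 mul1g. Qed.

(** Extended to a regular function on [G], [f] is evaluated at a composite of multiplications and an
    inversion. [B2] and [B1] pull functions back along the two pairs of factors being multiplied. *)
Lemma gconj_regular f : regular U f ->
  regular_prod (regular G) (regular U) (fun p => f (gconj p.1 p.2)).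
Proof.
move=> Uf; have [h Gh ->] := iota_closed ex Uf.
pose B := regular_prod (regular G) (regular U).
have Bsub : subalg B by exact: alg_gen_subalg.
have BG h' : regular G h' -> B (fun p => h' p.1).
  by move=> Gh'; apply: alg_gen_sub; left; exists h'.
have BU h' : regular G h' -> B (fun p => h' (iota p.2)).
  move=> Gh'; apply: alg_gen_sub; right; exists (h' \o iota) => //.
  exact: (alg_hom_regular iota Gh').
have B2 F : regular_prod (regular G) (regular G) F ->
    B (fun p => F (iota p.2, p.1^-1%g)).
  move: F; apply: (alg_gen_min (subalg_comp (fun p : G * U => (iota p.2, p.1^-1%g)) Bsub)).
  move=> _ [[h' Gh' ->]|[h' Gh' ->]]; first exact: BU.
  exact: (BG _ (algGroup_inv Gh')).
have B1 F : regular_prod (regular G) (regular G) F ->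
    B (fun p => F (p.1, iota p.2 * p.1^-1)%g).
  move: F; apply: (alg_gen_min (subalg_comp (fun p : G * U => (p.1, iota p.2 * p.1^-1)%g) Bsub)).
  move=> _ [[h' Gh' ->]|[h' Gh' ->]]; first exact: BG.
  exact: (B2 _ (algGroup_mul Gh')).
rewrite (_ : (fun p => _) = fun p : G * U => h (p.1 * (iota p.2 * p.1^-1))%g); last first.
  by apply: funext => p; rewrite /= gconjE mulgA.
exact: (B1 _ (algGroup_mul Gh)).
Qed.

Definition lin_comb n (q : 'I_n -> U -> k) (v : 'rV[k]_n) : U -> k :=
  fun u => \sum_i v 0 i * q i u.

(* If f (g u g^-1) = \sum_i p_i g * q_i u with as few terms as possible, then
   the q_i are a basis of the span of the G-orbit of f. *)
Lemma conj_rep f : regular U f ->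
  exists n (q : 'I_n -> U -> k) (sigma : rep G 'rV[k]_n),
    [/\ forall i, regular U (q i), exists v, f = lin_comb q v &
        forall g v u, lin_comb q (sigma g v) u = lin_comb q v (gconj g^-1%g u)].
Proof.
move=> Uf; have [n0 [p0 [q0 [Gp0 Uq0 E0]]]] :=
  regular_prod_sum (regular_subalg G) (regular_subalg U) (gconj_regular Uf).
have H0 : tensor_decomp (regular G) (regular U) (fun g u => f (gconj g u)) p0 q0 by [].
have [n [p [q [[Gp Uq fE] pI qI]]]] := tensor_decomp_indep
  (regular_subalg G) (regular_subalg U) H0.
have /choice[s sE] := lin_indep_points pI.
(* The points dual to [p] exhibit each [q j] as a combination of conjugates of [f], so the span of
   the [q] is stable under conjugation, with matrix [c]. *)
have qE j u : q j u = \sum_(r <- s j) r.1 * f (gconj r.2 u).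
  under eq_bigr do rewrite fE mulr_sumr.
  rewrite exchange_big (bigD1 j) //= [X in _ + X]big1 ?addr0 => [|i ij].
    under eq_bigr do rewrite mulrA.
    by rewrite -mulr_suml sE eqxx mul1r.
  under eq_bigr do rewrite mulrA.
  by rewrite -mulr_suml sE (negbTE ij) mul0r.
pose c h j l := \sum_(r <- s j) r.1 * p l (r.2 * h)%g.
have qc h j u : q j (gconj h u) = \sum_l c h j l * q l u.
  rewrite qE; under eq_bigr do rewrite -gconjM fE mulr_sumr.
  rewrite exchange_big; apply: eq_bigr => l _; rewrite mulr_suml.
  by apply: eq_bigr => r _; rewrite mulrA.
have q_inj (a b : 'I_n -> k) :
    (forall u, \sum_i a i * q i u = \sum_i b i * q i u) -> forall i, a i = b i.
  move=> E i; apply/eqP; rewrite -subr_eq0; apply/eqP; move: i; apply: qI => u.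
  by under eq_bigr do rewrite mulrBl; rewrite sumrB E subrr.
have c_reg j l : regular G (fun h => c h j l).
  by apply: subalg_sum => // r _; apply: subalgZ => //; exact: regular_translate.
pose C h : 'M[k]_n := \matrix_(j, l) c h j l.
have C1 : C 1%g = 1%:M.
  apply/matrixP => j; apply: q_inj => u; under eq_bigr do rewrite mxE.
  rewrite -qc gconj1g (bigD1 j) //= big1 => [|i ij]; first by rewrite mxE eqxx mul1r addr0.
  by rewrite mxE eq_sym (negbTE ij) mul0r.
have CM g h : C (g * h)%g = C g *m C h.
  apply/matrixP => j; apply: q_inj => u; under eq_bigr do rewrite mxE.
  rewrite -qc gconjM qc; under eq_bigr do rewrite qc mulr_sumr.
  rewrite exchange_big; apply: eq_bigr => l _; rewrite mxE mulr_suml.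
  by apply: eq_bigr => i _; rewrite !mxE mulrA.
(* Multiplication of row vectors by [C g] is a right action; the inverse makes it a left one. *)
pose act g : 'End('rV[k]_n) := linfun (mulmxr (C g^-1%g)).
have actE g v : act g v = v *m C g^-1%g by rewrite lfunE.
have act1 : act 1%g = \1%VF.
  by apply/lfunP => v; rewrite actE id_lfunE invg1 C1 mulmx1.
have actM g h : act (g * h)%g = (act g \o act h)%VF.
  by apply/lfunP => v; rewrite comp_lfunE !actE invgM CM mulmxA.
have act_reg v (l : 'Hom('rV[k]_n, k^o)) : regular G (fun g => l (act g v)).
  under eq_fun do rewrite row_formE actE.
  apply: subalg_sum => // i _; apply: subalgM => //; last exact: (subalgC (regular_subalg G)).
  under eq_fun do rewrite mxE.
  apply: subalg_sum => // j _; apply: subalgZ => //.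
  under eq_fun do rewrite mxE.
  exact: (algGroup_inv (c_reg j i)).
exists n, q, (Rep act1 actM act_reg); split=> // [|g v u].
  exists (\row_i p i 1%g); apply: funext => u; rewrite -[u in LHS]gconj1g fE.
  by apply: eq_bigr => i _; rewrite mxE.
rewrite /lin_comb /= actE; under [RHS]eq_bigr do rewrite qc mulr_sumr.
rewrite exchange_big; apply: eq_bigr => l _; rewrite mxE mulr_suml.
by apply: eq_bigr => j _; rewrite mxE mulrA.
Qed.

End Conjugation.

(** * Weight vectors in k[U] *)

Section LieAlgebra.
Variables (k : closedFieldType) (U : algGroup k) (D : (U -> k) -> k).
Hypothesis D_lie : lie_alg D.

Lemma lie_algZD c f g : regular U f -> regular U g ->
  D (fun u => c * f u + g u) = c * D f + D g.
Proof. by have [DE _ _] := D_lie; exact: DE. Qed.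

Lemma lie_algC c : D (fun=> c) = 0.
Proof.
have UC a : regular U (fun=> a) by exact: (subalgC (regular_subalg U)).
have [_ DM _] := D_lie.
have D1 : D (fun=> 1) = 0.
  have := DM (fun=> 1) (fun=> 1) (UC 1) (UC 1).
  have -> : (fun=> 1) * (fun=> 1) = (fun=> 1) :> (U -> k).
    by apply: funext => u; exact: mulr1.
  by rewrite mul1r mulr1 => /eqP; rewrite -subr_eq0 opprD addrA subrr add0r oppr_eq0 => /eqP.
have D0 : D (fun=> 0) = 0.
  have := lie_algZD (-1) (UC 0) (UC 0).
  rewrite (_ : (fun u => _) = (fun=> 0)); last by apply: funext => u; rewrite mulr0 addr0.
  by rewrite mulN1r addNr.
have := lie_algZD c (UC 1) (UC 0); rewrite D1 D0 mulr0.
by rewrite (_ : (fun u => _) = (fun=> c)) ?addr0 //; apply: funext => u; rewrite mulr1 ?addr0.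
Qed.

Lemma lie_algZ c f : regular U f -> D (fun u => c * f u) = c * D f.
Proof.
move=> Uf; have := lie_algZD c Uf (subalgC (regular_subalg U) 0).
by rewrite lie_algC addr0 => <-; under [in RHS]eq_fun do rewrite addr0.
Qed.

Lemma lie_alg_sub1 f : regular U f -> D (fun u => f u - f 1%g) = D f.
Proof.
move=> Uf; have := lie_algZD 1 Uf (subalgC (regular_subalg U) (- f 1%g)).
by rewrite lie_algC addr0 mul1r => <-; under [in RHS]eq_fun do rewrite mul1r.
Qed.

Lemma lie_alg_sum (I : Type) (s : seq I) (F : I -> U -> k) :
  (forall i, regular U (F i)) -> D (fun u => \sum_(i <- s) F i u) = \sum_(i <- s) D (F i).
Proof.
move=> UF; elim: s => [|i s IH].
  by rewrite big_nil -[RHS](lie_algC 0); congr D; apply: funext => u; rewrite big_nil.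
rewrite big_cons -IH -[D (F i)]mul1r -lie_algZD //; last exact: subalg_sum.
by congr D; apply: funext => u; rewrite big_cons mul1r.
Qed.

End LieAlgebra.

Section WeightFunctions.
Variables (k : closedFieldType) (U G T : algGroup k).
Variables (iota : algHom U G) (pi : algHom G T).
Hypothesis ex : short_exact iota pi.
Hypothesis T_torus : torus T.

Lemma regular_gconj g f : regular U f -> regular U (fun u => f (gconj ex g u)).
Proof.
move=> Uf; have [n [p [q [_ Uq E]]]] :=
  regular_prod_sum (regular_subalg G) (regular_subalg U) (gconj_regular ex Uf).
rewrite (_ : (fun u => _) = fun u => \sum_i p i g * q i u); last first.
  by apply: funext => u; rewrite -E.
by apply: subalg_sum => // i _; exact: subalgZ.
Qed.

(* The square of the maximal ideal of k[U] at 1. *)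
Inductive max_sq : (U -> k) -> Prop :=
| max_sq0 : max_sq (fun=> 0)
| max_sqMD f g h : regular U f -> f 1%g = 0 -> regular U g -> g 1%g = 0 ->
    max_sq h -> max_sq (fun u => f u * g u + h u).

Lemma max_sqD f g : max_sq f -> max_sq g -> max_sq (fun u => f u + g u).
Proof.
elim=> [|f1 f2 f3 Uf1 f11 Uf2 f21 _ IH] sg; first by under eq_fun do rewrite add0r.
by under eq_fun do rewrite -addrA; apply: max_sqMD => //; exact: IH.
Qed.

Lemma max_sqZ c f : max_sq f -> max_sq (fun u => c * f u).
Proof.
elim=> [|f1 f2 f3 Uf1 f11 Uf2 f21 _ IH].
  by under eq_fun do rewrite mulr0; exact: max_sq0.
under eq_fun do rewrite mulrDr mulrA; apply: (@max_sqMD (fun u => c * f1 u)) => //.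
  exact: subalgZ.
by rewrite f11 mulr0.
Qed.

Lemma max_sqB f g : max_sq f -> max_sq g -> max_sq (fun u => f u - g u).
Proof.
by move=> sf sg; under eq_fun do rewrite -mulN1r; apply: max_sqD => //; exact: max_sqZ.
Qed.

Lemma max_sq_gconj g f : max_sq f -> max_sq (fun u => f (gconj ex g u)).
Proof.
elim=> [|f1 f2 f3 Uf1 f11 Uf2 f21 _ IH]; first exact: max_sq0.
by apply: max_sqMD; rewrite ?gconj1 //; exact: regular_gconj.
Qed.

Lemma max_sq_sum (I : Type) (s : seq I) (F : I -> U -> k) :
  (forall i, max_sq (F i)) -> max_sq (fun u => \sum_(i <- s) F i u).
Proof.
move=> sF; elim: s => [|i s IH].
  by rewrite (_ : (fun u => _) = fun=> 0); [exact: max_sq0|apply: funext => u; rewrite big_nil].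
rewrite (_ : (fun u => _) = fun u => F i u + \sum_(j <- s) F j u); first exact: max_sqD.
by apply: funext => u; rewrite big_cons.
Qed.

Lemma lie_alg_max_sq (D : (U -> k) -> k) f :
  lie_alg (H := U) D -> max_sq f -> regular U f /\ D f = 0.
Proof.
move=> D_lie; elim=> [|f1 f2 f3 Uf1 f11 Uf2 f21 _ [Uf3 Df3]].
  by split; [exact: (subalgC (regular_subalg U))|exact: lie_algC].
have U12 : regular U (f1 * f2) by exact: (subalgM (regular_subalg U)).
split; first exact: (subalgD (regular_subalg U)).
have [_ DM _] := D_lie; have := lie_algZD D_lie 1 U12 Uf3.
rewrite DM // f11 f21 Df3 mul0r mulr0 !addr0 mulr0 => <-.
by congr D; apply: funext => u; rewrite mul1r.
Qed.

Variable alpha : section pi.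

(** The sign matches [lie_weight]: a form of Lie weight [m] can be nonzero on [f] only if [m] is
    [l]. *)
Definition weight_fun (l : char T) (f : U -> k) :=
  regular U f /\ forall t u, f (gconj ex (alpha t) u) = char_val l t * f u.

Lemma weight_fun_sub1 l f : weight_fun l f -> weight_fun l (fun u => f u - f 1%g).
Proof.
move=> [Uf fE]; split; first by apply: subalgB => //; exact: (subalgC (regular_subalg U)).
by move=> t u; rewrite mulrBr -!fE gconj1.
Qed.

Lemma weight_funM l l' f g : weight_fun l f -> weight_fun l' g ->
  weight_fun (l + l') (fun u => f u * g u).
Proof.
move=> [Uf fE] [Ug gE]; split; first exact: subalgM.
by move=> t u; rewrite fE gE char_valD mulrACA.
Qed.

Lemma weight_funC c : weight_fun 0 (fun=> c).
Proof.
split; first exact: (subalgC (regular_subalg U)).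
by move=> t u; rewrite char_val0 mul1r.
Qed.

(** The weight changes sign because [sigma g] is composition with conjugation by the inverse of
    [g]. *)
Lemma rep_weight_fun n (q : 'I_n -> U -> k) (sigma : rep G 'rV[k]_n) x v :
  (forall i, regular U (q i)) ->
  (forall g v u, lin_comb q (sigma g v) u = lin_comb q v (gconj ex g^-1%g u)) ->
  rep_weight (rep_comp sigma alpha) x v -> weight_fun (- x) (lin_comb q v).
Proof.
move=> Uq qE vx; split; first by apply: subalg_sum => // i _; exact: subalgZ.
move=> t u; rewrite -[alpha t]invgK -qE -alg_homV [sigma _ _]vx char_valV char_valN.
by rewrite /lin_comb mulr_sumr; apply: eq_bigr => i _; rewrite mxE mulrA.
Qed.

Lemma weight_fun_decomp f : regular U f -> exists s : seq (char T * (U -> k)),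
  (forall p, p \in s -> weight_fun p.1 p.2) /\ forall u, f u = \sum_(p <- s) p.2 u.
Proof.
move=> Uf; have [n [q [sigma [Uq [v ->] qE]]]] := conj_rep ex Uf.
have [S [e eP]] := torus_weight_proj (rep_comp sigma alpha) T_torus.
exists [seq (- x, lin_comb q (e x v)) | x <- S]; split=> [_ /mapP[x _ ->]|u] /=.
  exact: rep_weight_fun (weight_proj_weight eP x v).
rewrite big_map /lin_comb exchange_big; apply: eq_bigr => i _ /=.
by rewrite -mulr_suml [v in LHS](weight_proj_sum eP v) summxE.
Qed.

(** The group algebra element isolating [l] fixes [f] and kills every piece of another weight in the
    list. *)
Lemma weight_fun_proj l f (s : seq (char T * (U -> k))) : weight_fun l f ->
  (forall p, p \in s -> weight_fun p.1 p.2) -> (forall u, f u = \sum_(p <- s) p.2 u) ->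
  forall u, f u = \sum_(p <- s | p.1 == l) p.2 u.
Proof.
move=> [_ fE] sP fs u; have [r [r1 r0]] := char_proj (map fst s) l.
have -> : f u = \sum_(a <- r) a.1 * f (gconj ex (alpha a.2) u).
  by under eq_bigr do rewrite fE mulrA; rewrite -mulr_suml r1 mul1r.
under eq_bigr do rewrite fs mulr_sumr.
rewrite exchange_big [RHS]big_mkcond /= [LHS]big_seq [RHS]big_seq.
apply: eq_bigr => p ps; have [_ pE] := sP p ps.
under eq_bigr do rewrite pE mulrA.
rewrite -mulr_suml; have [->|pl] := eqVneq; first by rewrite r1 mul1r.
by rewrite r0 ?mul0r //; exact: map_f.
Qed.

(** The weight components of finitely many generators still generate; subtracting their values at 1
    is harmless, since a subalgebra contains the constants. *)
Lemma weight_generators : exists n (a : 'I_n -> U -> k) (x : 'I_n -> char T),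
  [/\ forall i, weight_fun (x i) (a i), forall i, a i 1%g = 0 &
      forall B, subalg B -> (forall i, B (a i)) -> regular U `<=` B].
Proof.
have [m [s Us]] := affine_fingen (algGroup_affine U).
have sU i : regular U (s i) by rewrite Us; apply: alg_gen_sub; exists i.
have /choice[d dP] i := weight_fun_decomp (sU i).
pose L := flatten [seq d i | i <- enum 'I_m].
have LW p : p \in L -> weight_fun p.1 p.2.
  by move=> /flattenP[_ /mapP[i _ ->] pd]; have [H _] := dP i; exact: H.
pose p i := tnth (in_tuple L) i.
exists (size L), (fun i u => (p i).2 u - (p i).2 1%g), (fun i => (p i).1); split=> [i|i|B Bsub Ba].
- by apply: weight_fun_sub1; apply: LW; exact: mem_tnth.
- by rewrite subrr.
have BL q : q \in L -> B q.2.
  move=> /(tnthP (in_tuple L))[i ->].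
  have := subalgD Bsub (Ba i) (subalgC Bsub ((p i).2 1%g)).
  by under eq_fun do rewrite subrK.
rewrite Us; apply: alg_gen_min => // _ [i _ <-].
have -> : s i = fun u => \sum_(j < size (d i)) (tnth (in_tuple (d i)) j).2 u.
  by apply: funext => u; rewrite (dP i).2 big_tnth.
apply: subalg_sum => // j _; apply: BL; apply/flattenP; exists (d i).
  by apply: map_f; rewrite mem_enum.
exact: mem_tnth.
Qed.

(* The linear form D is built on m / m^2, which is spanned by the weight
   vectors a i, and extended by 0 on the constants and on m^2. *)
Lemma lie_weight_fun l f : weight_fun l f -> ~ max_sq (fun u => f u - f 1%g) ->
  lie_weights ex alpha l.
Proof.
move=> fl fsq; have [n [a [x [aW a1 gen]]]] := weight_generators.
have Ua i : regular U (a i) by have [] := aW i.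
pose ev := lin_comb a.
have ev_lin b c d u : ev (b *: c + d) u = b * ev c u + ev d u.
  rewrite /ev /lin_comb mulr_sumr -big_split /=; apply: eq_bigr => i _.
  by rewrite !mxE mulrDl mulrA.
have evU c : regular U (ev c) by apply: subalg_sum => // i _; exact: subalgZ.
have ev1 c : ev c 1%g = 0 by rewrite /ev /lin_comb big1 // => i _; rewrite a1 mulr0.
(* The row [c] gives the linear part of [g] at 1 in terms of the [a i]. It need not be unique, as
   the [a i] may be dependent modulo m^2. *)
pose lin g c := max_sq (fun u => g u - g 1%g - ev c u).
have linP g : regular U g -> exists c, lin g c.
  move=> Ug; suff [] : [set g | regular U g /\ exists c, lin g c] g by [].
  move: g Ug; apply: gen => [|i]; last first.
    split=> //; exists (delta_mx 0 i); rewrite /lin (_ : (fun u => _) = fun=> 0); first exact: max_sq0.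
    apply: funext => u; rewrite a1 subr0 /ev /lin_comb (bigD1 i) //= big1 => [|j ji].
      by rewrite mxE !eqxx mul1r addr0 subrr.
    by rewrite mxE (negbTE ji) andbF mul0r.
  split=> [b|g h [Ug [c gc]] [Uh [d hd]]|g h [Ug [c gc]] [Uh [d hd]]].
  - split; first exact: (subalgC (regular_subalg U)).
    exists 0; rewrite /lin (_ : (fun u => _) = fun=> 0); first exact: max_sq0.
    by apply: funext => u; rewrite /= subrr sub0r /ev /lin_comb big1 ?oppr0 // => i _; rewrite mxE mul0r.
  - split; first exact: (subalgD (regular_subalg U)).
    exists (1 *: c + d); rewrite /lin.
    rewrite (_ : (fun u => _) = fun u => (g u - g 1%g - ev c u) + (h u - h 1%g - ev d u)).
      exact: max_sqD.
    apply: funext => u; rewrite ev_lin -[(g + h) u]/(g u + h u) -[(g + h) 1%g]/(g 1%g + h 1%g).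
    by ring.
  - split; first exact: (subalgM (regular_subalg U)).
    exists (g 1%g *: d + (h 1%g *: c + 0)); rewrite /lin.
    rewrite (_ : (fun u => _) = fun u => (g u - g 1%g) * (h u - h 1%g) +
      (g 1%g * (h u - h 1%g - ev d u) + h 1%g * (g u - g 1%g - ev c u))).
      apply: max_sqMD; rewrite ?subrr //; last by apply: max_sqD; exact: max_sqZ.
        by apply: subalgB => //; exact: (subalgC (regular_subalg U)).
      by apply: subalgB => //; exact: (subalgC (regular_subalg U)).
    apply: funext => u; rewrite !ev_lin -[(g * h) u]/(g u * h u) -[(g * h) 1%g]/(g 1%g * h 1%g).
    have -> : ev 0 u = 0 by rewrite /ev /lin_comb big1 // => i _; rewrite mxE mul0r.
    by ring.
have [r [r1 r0]] := char_proj (codom x) l.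
pose P (g : U -> k) u := \sum_(b <- r) b.1 * g (gconj ex (alpha b.2) u).
have Psq g : max_sq g -> max_sq (P g).
  move=> sg; apply: max_sq_sum => b; apply: max_sqZ; exact: max_sq_gconj.
pose pr (c : 'rV[k]_n) := \row_i (if x i == l then c 0 i else 0).
have Pev c u : P (ev c) u = ev (pr c) u.
  rewrite /P /ev /lin_comb; under eq_bigr do rewrite mulr_sumr.
  rewrite exchange_big; apply: eq_bigr => i _; rewrite mxE.
  have [_ aE] := aW i; under eq_bigr do rewrite aE mulrCA [_ * (_ * a i u)]mulrA.
  rewrite -mulr_sumr -mulr_suml; have [->|xl] := eqVneq; first by rewrite r1 mul1r.
  by rewrite r0 ?codom_f // !mul0r mulr0.
(* A form vanishing on [Z] descends to m / m^2 and depends only on the component of weight [l],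
   because [Z] contains the rows with [ev c] in m^2 and those with [pr c] zero. *)
pose Z : set 'rV[k]_n := [set c | max_sq (ev (pr c))].
have ZE c : c \in vspan Z <-> Z c.
  apply: mem_vspan_closed => [|b c1 c2 Zc1 Zc2]; rewrite /Z /=.
    rewrite (_ : ev _ = fun=> 0); first exact: max_sq0.
    by apply: funext => u; rewrite /ev /lin_comb big1 // => i _; rewrite !mxE if_same mul0r.
  have -> : pr (b *: c1 + c2) = b *: pr c1 + pr c2.
    by apply/rowP => i; rewrite !mxE; case: ifP => //; rewrite mulr0 addr0.
  rewrite (_ : ev _ = fun u => b * ev (pr c1) u + ev (pr c2) u); last exact: funext (ev_lin _ _ _).
  by apply: max_sqD => //; exact: max_sqZ.
have sqZ c : max_sq (ev c) -> c \in vspan Z.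
  by move=> /Psq sc; apply/ZE; rewrite /Z /= -(_ : P (ev c) = ev (pr c)) //; apply: funext => u.
have [cf fcf] := linP f fl.1.
have cfZ : cf \notin vspan Z.
  apply/negP => /ZE Zcf; apply: fsq; move/Psq: fcf => /max_sqD /(_ Zcf).
  rewrite (_ : (fun u => _) = fun u => f u - f 1%g) // /P; apply: funext => u.
  have [_ fE] := weight_fun_sub1 fl; rewrite -Pev /P -big_split /=.
  under eq_bigr do rewrite -mulrDr subrK fE mulrA.
  by rewrite -mulr_suml r1 mul1r.
have [phi [phiZ phif]] := separating_form cfZ.
have phiE c c' : max_sq (fun u => ev c u - ev c' u) -> phi c = phi c'.
  move=> s; apply/eqP; rewrite -subr_eq0 -linearB; apply/eqP; apply: phiZ; apply: sqZ.
  rewrite (_ : ev _ = fun u => ev c u - ev c' u) //; apply: funext => u.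
  by rewrite -scaleN1r addrC ev_lin mulN1r addrC.
(* The value does not depend on the chosen row, by [phiE]; off k[U] it is 0, as the encoding of the
   Lie algebra demands. *)
pose D (g : U -> k) : k := if pselect (regular U g) is left Ug then phi (sval (cid (linP g Ug))) else 0.
have DE g c : regular U g -> lin g c -> D g = phi c.
  move=> Ug gc; rewrite /D; case: pselect => // Ug'; case: cid => c' /= gc'.
  apply: phiE; move: (max_sqB gc gc'); rewrite (_ : (fun u => _) = fun u => ev c' u - ev c u) //.
  by apply: funext => u; ring.
exists D; last first.
  by move=> D0; move/eqP: phif; rewrite -(DE f cf fl.1 fcf) D0.
split; first split=> [b g h Ug Uh|g h Ug Uh|g Ug].
- have [[c gc] [d hd]] := (linP g Ug, linP h Uh).
  rewrite (DE g c) // (DE h d) // (DE _ (b *: c + d)); first by rewrite linearP.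
    by apply: (subalgD (regular_subalg U)) => //; exact: (subalgZ (regular_subalg U)).
  rewrite /lin (_ : (fun u => _) = fun u => b * (g u - g 1%g - ev c u) + (h u - h 1%g - ev d u)).
    by apply: max_sqD => //; exact: max_sqZ.
  apply: funext => u; rewrite ev_lin -[(cst b * g + h) u]/(b * g u + h u).
  by rewrite -[(cst b * g + h) 1%g]/(b * g 1%g + h 1%g); ring.
- have [[c gc] [d hd]] := (linP g Ug, linP h Uh).
  rewrite (DE g c) // (DE h d) // (DE _ (g 1%g *: d + h 1%g *: c)).
  + by rewrite linearP linearZ /= [_ *: _ in X in _ + X]mulrC.
  + exact: (subalgM (regular_subalg U)).
  rewrite -[h 1%g *: c]addr0 /lin.
  rewrite (_ : (fun u => _) = fun u => (g u - g 1%g) * (h u - h 1%g) +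
    (g 1%g * (h u - h 1%g - ev d u) + h 1%g * (g u - g 1%g - ev c u))).
    apply: max_sqMD; rewrite ?subrr //; last by apply: max_sqD; exact: max_sqZ.
      by apply: subalgB => //; exact: (subalgC (regular_subalg U)).
    by apply: subalgB => //; exact: (subalgC (regular_subalg U)).
  apply: funext => u; rewrite !ev_lin -[(g * h) u]/(g u * h u) -[(g * h) 1%g]/(g 1%g * h 1%g).
  have -> : ev 0 u = 0 by rewrite /ev /lin_comb big1 // => i _; rewrite mxE mul0r.
  by ring.
- by rewrite /D; case: pselect.
move=> t g Ug; have [c gc] := linP g Ug; rewrite conj_act_gconj.
pose c' : 'rV[k]_n := \row_i (char_val (x i) t * c 0 i).
rewrite (DE g c) // (DE _ c'); first last.
- rewrite /lin; have := max_sq_gconj (alpha t) gc.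
  rewrite (_ : (fun u => _) = fun u => (g \o gconj ex (alpha t)) u -
     (g \o gconj ex (alpha t)) 1%g - ev c' u) //; apply: funext => u /=.
  rewrite gconj1; congr (_ - _); apply: eq_bigr => i _.
  by have [_ ->] := aW i; rewrite mxE mulrCA mulrA.
- exact: regular_gconj.
apply/eqP; rewrite -subr_eq0; have <- : phi (c' - char_val l t *: c) = phi c' - char_val l t * phi c.
  by rewrite linearB linearZ.
(* At the indices of weight [l] the coordinates of [c' - char_val l t *: c] vanish, so its image
   under [pr] is 0. *)
apply/eqP; apply: phiZ; apply/ZE; rewrite /Z /=.
rewrite (_ : ev _ = fun=> 0); first exact: max_sq0.
apply: funext => u; rewrite /ev /lin_comb big1 // => i _; rewrite !mxE.
by case: eqP => [->|_]; rewrite ?subrr mul0r.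
Qed.

End WeightFunctions.

(** * Weights outside the cone and Nakayama's lemma *)

Section Nakayama.
Variables (k : closedFieldType) (U G T : algGroup k).
Variables (iota : algHom U G) (pi : algHom G T).
Hypothesis ex : short_exact iota pi.
Hypothesis T_torus : torus T.
Variable alpha : section pi.

Let C := weight_cone ex alpha.
Let wf := weight_fun ex alpha.

(* The weight vectors outside the cone generate an ideal Q with Q = m Q, so Q
   vanishes wherever the determinant given by Nakayama's lemma does not. *)
Lemma bad_weights_vanish : exists d : U -> k, [/\ regular U d, d 1%g = 1 &
  forall l f, wf l f -> ~ C l -> forall u, d u != 0 -> f u = 0].
Proof.
have [n [a [x [aW a1 gen]]]] := weight_generators ex T_torus alpha.
(* Generators with weight in the cone are replaced by 0, which keeps a square system indexed by
   ['I_n]; the [b i] generate [Q]. *)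
pose b i : U -> k := if pselect (C (x i)) then fun=> 0 else a i.
have Ub i : regular U (b i).
  rewrite /b; case: pselect => [?|?]; last exact: (aW i).1.
  exact: (subalgC (regular_subalg U)).
have b1 i : b i 1%g = 0 by rewrite /b; case: pselect => [?|?] //; exact: a1.
pose Q : set (U -> k) := [set g | exists c : 'I_n -> U -> k,
  (forall i, regular U (c i)) /\ forall u, g u = \sum_i c i u * b i u].
pose mQ : set (U -> k) := [set g | exists c : 'I_n -> U -> k,
  [/\ forall i, regular U (c i), forall i, c i 1%g = 0 & forall u, g u = \sum_i c i u * b i u]].
have Q1 g : Q g -> g 1%g = 0.
  by move=> [c [_ ->]]; rewrite big1 // => i _; rewrite b1 mulr0.
have QM g h : Q g -> regular U h -> Q (fun u => h u * g u).
  move=> [c [Uc cE]] Uh; exists (fun i u => h u * c i u); split=> [i|u].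
    exact: subalgM.
  by rewrite cE mulr_sumr; apply: eq_bigr => i _; rewrite mulrA.
have mQM g h : Q g -> regular U h -> h 1%g = 0 -> mQ (fun u => h u * g u).
  move=> [c [Uc cE]] Uh h1; exists (fun i u => h u * c i u); split=> [i|i|u].
  - exact: subalgM.
  - by rewrite h1 mul0r.
  - by rewrite cE mulr_sumr; apply: eq_bigr => i _; rewrite mulrA.
pose decomp (E : set (U -> k)) g (s : seq (char T * (U -> k))) :=
  (forall p, p \in s -> wf p.1 p.2 /\ (C p.1 \/ E p.2)) /\ forall u, g u = \sum_(p <- s) p.2 u.
have cat_decomp E g h s s' : decomp E g s -> decomp E h s' ->
    decomp E (fun u => g u + h u) (s ++ s').
  move=> [sW sE] [sW' sE']; split=> [p|u]; last by rewrite big_cat /= -sE -sE'.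
  by rewrite mem_cat => /orP[/sW|/sW'].
pose mul (s s' : seq (char T * (U -> k))) :=
  [seq (p.1 + q.1, (fun u => p.2 u * q.2 u)) | p <- s, q <- s'].
have mul_sum s s' u : \sum_(p <- mul s s') p.2 u =
    (\sum_(p <- s) p.2 u) * \sum_(q <- s') q.2 u.
  rewrite /mul big_allpairs_dep mulr_suml; apply: eq_bigr => p _.
  by rewrite mulr_sumr.
(* In a product of two pieces, either both weights are in the cone and so is their sum, or one
   factor is in the ideal [Q]. *)
have decompQ g : regular U g -> exists s, decomp Q g s.
  move: g; apply: gen => [|i]; last first.
    exists [:: (x i, a i)]; split=> [p|u]; last by rewrite big_seq1.
    rewrite inE => /eqP-> /=; split; first exact: aW.
    have [Cx|Cx] := pselect (C (x i)); [by left|right].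
    exists (fun j u => (j == i)%:R); split=> [j|u]; first exact: (subalgC (regular_subalg U)).
    rewrite (bigD1 i) //= big1 ?addr0 => [|j /negbTE->]; last by rewrite mul0r.
    by rewrite eqxx mul1r /b; case: pselect.
  split=> [c|g h [s gs] [s' hs]|g h [s [sW sE]] [s' [sW' sE']]].
  - exists [:: (0, fun=> c)]; split=> [p|u]; last by rewrite big_seq1.
    rewrite inE => /eqP-> /=; split; first exact: weight_funC.
    by left; exact: weight_cone0.
  - by exists (s ++ s'); exact: cat_decomp.
  exists (mul s s'); split=> [_ /allpairsP[[p q] /= [ps qs ->]]|u] /=; last first.
    by rewrite mul_sum -sE -sE'.
  have [[pW pC] [qW qC]] := (sW p ps, sW' q qs); split; first exact: weight_funM.
  case: pC => [Cp|Qp]; last first.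
    by right; under eq_fun do rewrite mulrC; apply: QM => //; have [] := qW.
  case: qC => [Cq|Qq]; first by left; exact: weight_coneD.
  by right; apply: QM => //; have [] := pW.
have decompQ1 g : regular U g -> g 1%g = 0 ->
    exists s, decomp Q g s /\ forall p, p \in s -> p.2 1%g = 0.
  move=> Ug g1; have [s [sW sE]] := decompQ g Ug.
  exists [seq (p.1, (fun u => p.2 u - p.2 1%g)) | p <- s]; split=> [|_ /mapP[p _ ->] /=]; last by rewrite subrr.
  split=> [_ /mapP[p ps ->] /=|u]; last first.
    by rewrite big_map /= sumrB -!sE g1 subr0.
  have [pW pC] := sW p ps; split; first exact: weight_fun_sub1.
  case: pC => [Cp|Qp]; [by left|right].
  by under eq_fun do rewrite (Q1 _ Qp) subr0.
(* Here both factors can be split into pieces vanishing at 1, so a piece in [Q] is multiplied by an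
   element of m. *)
have decompmQ g : max_sq g -> exists s, decomp mQ g s.
  elim=> [|f1 f2 f3 Uf1 f11 Uf2 f21 _ [s3 sf3]].
    by exists [::]; split=> // u; rewrite big_nil.
  have [s [[sW sE] s1]] := decompQ1 f1 Uf1 f11.
  have [s' [[sW' sE'] s1']] := decompQ1 f2 Uf2 f21.
  exists (mul s s' ++ s3); apply: cat_decomp => //.
  split=> [_ /allpairsP[[p q] /= [ps qs ->]]|u] /=; last by rewrite mul_sum -sE -sE'.
  have [[pW pC] [qW qC]] := (sW p ps, sW' q qs); split; first exact: weight_funM.
  case: pC => [Cp|Qp]; last first.
    by right; under eq_fun do rewrite mulrC; apply: mQM Qp qW.1 (s1' q qs).
  case: qC => [Cq|Qq]; first by left; exact: weight_coneD.
  by right; apply: mQM Qq pW.1 (s1 p ps).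
have /choice[q qP] i : exists c : 'I_n -> U -> k,
    [/\ forall j, regular U (c j), forall j, c j 1%g = 0 & forall u, b i u = \sum_j c j u * b j u].
  have [Cx|Cx] := pselect (C (x i)).
    exists (fun _ _ => 0); split=> [j|//|u]; first exact: (subalgC (regular_subalg U)).
    rewrite big1 => [|j _]; last by rewrite mul0r.
    by rewrite /b; case: pselect.
  (* Otherwise [lie_weight_fun] would make [x i] a weight of the Lie algebra, hence an element of
     the cone. *)
  have sq_a : max_sq (a i).
    apply: contrapT => nsq; apply: Cx; apply: weight_cone_weight.
    apply: (lie_weight_fun T_torus (aW i)) => sq; apply: nsq.
    by move: sq; under eq_fun do rewrite a1 subr0.
  have [s [sW sE]] := decompmQ _ sq_a.
  (* Only the pieces of weight [x i] contribute to [a i], and they are all in [mQ] because [x i] is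
     outside the cone. *)
  have aE := weight_fun_proj (aW i) (fun p ps => (sW p ps).1) sE.
  have smQ p : p \in s -> p.1 == x i -> mQ p.2.
    by move=> ps /eqP px; have [_ []] := sW p ps; rewrite // px => /Cx.
  have biE : b i = a i by rewrite /b; case: pselect => [h|?] //; case: (Cx h).
  suff: mQ (fun u => \sum_(p <- s | p.1 == x i) p.2 u).
    by move=> [c [Uc c1 cE]]; exists c; split=> // u; rewrite biE aE.
  elim: s smQ {sW sE aE} => [_|p s IH smQ].
    exists (fun _ _ => 0); split=> [j|//|u].
      exact: (subalgC (regular_subalg U)).
    by rewrite big_nil big1 // => j _; rewrite mul0r.
  have [c [Uc c1 cE]] := IH (fun q qs => smQ q (mem_behead (s := p :: s) qs)).
  have [px|px] := boolP (p.1 == x i); last first.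
    by exists c; split=> // u; rewrite big_cons (negbTE px).
  have [c' [Uc' c1' cE']] := smQ p (mem_head _ _) px.
  exists (fun j u => c' j u + c j u); split=> [j|j|u]; first exact: subalgD.
    by rewrite c1 c1' addr0.
  rewrite big_cons px cE cE' -big_split; apply: eq_bigr => j _ /=.
  by rewrite mulrDl.
(* The column [b] satisfies N b = 0. Since the [q i j] vanish at 1, the determinant of [N] is 1
   there, and [b] vanishes wherever this determinant is nonzero. *)
pose N i j u := (i == j)%:R - q i j u.
exists (fun u => \det (\matrix_(i, j) N i j u)); split.
- apply: subalg_det => // i j; apply: subalgB => //; first exact: (subalgC (regular_subalg U)).
  by have [] := qP i.
- rewrite (_ : \matrix_(i, j) _ = 1%:M) ?det1 //; apply/matrixP => i j.
  by rewrite !mxE /N; have [_ -> _] := qP i; rewrite subr0.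
move=> l f fl Cl u du.
have b0 i : b i u = 0.
  pose B : 'cV[k]_n := \col_i b i u.
  have NB : (\matrix_(i, j) N i j u) *m B = 0.
    apply/colP => j; rewrite !mxE; under eq_bigr do rewrite !mxE /N mulrBl.
    rewrite sumrB; have [_ _ <-] := qP j; rewrite (bigD1 j) //= big1 => [|i' ij].
      by rewrite eqxx mul1r addr0 subrr.
    by rewrite eq_sym (negbTE ij) mul0r.
  have NU : \matrix_(i, j) N i j u \in unitmx by rewrite unitmxE unitfE.
  have : B = 0 by rewrite -[B](mulKmx NU) NB mulmx0.
  by move/colP/(_ i); rewrite !mxE.
have [s [sW sE]] := decompQ f fl.1.
rewrite (weight_fun_proj fl (fun p ps => (sW p ps).1) sE) big_seq_cond big1 // => p /andP[ps /eqP pl].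
have [_ [|[c [_ ->]]]] := sW p ps; first by rewrite pl => /Cl.
by rewrite big1 // => i _; rewrite b0 mulr0.
Qed.

End Nakayama.

(** * Stability *)

Section Stability.
Variables (k : closedFieldType) (U G T : algGroup k).
Variables (iota : algHom U G) (pi : algHom G T).
Hypothesis ex : short_exact iota pi.
Hypothesis T_torus : torus T.
Hypothesis N_unipotent : connected_normal_unipotent (range iota).
Variables (V : vectType k) (rho : rep G V) (alpha : section pi) (m : char T).

Let F := weight_mfilt ex rho alpha m.

(** A coefficient of [iota(U)] from the weight space of [y] to that of [x] is a weight function of
    weight [x - y]. If [y] is above [m] and [x] is not, then [x - y] is outside the cone, and the
    coefficient vanishes where [d] does not. *)
Lemma weight_mfilt_near1 : exists d : U -> k, [/\ regular U d, d 1%g = 1 &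
  forall u, d u != 0 -> forall v, v \in F -> rho (iota u) v \in F].
Proof.
have [d [Ud d1 dP]] := bad_weights_vanish ex T_torus alpha; exists d; split=> // u du.
have [S [e eP]] := torus_weight_proj (rep_comp rho alpha) T_torus.
move=> v /(mem_weight_mfilt ex eP) vF; apply/(mem_weight_mfilt ex eP) => x mx.
rewrite [v](weight_proj_sum eP) !linear_sum big1 // => y _ /=.
have [my|my] := pselect (pre_le (weight_cone ex alpha) m y); last by rewrite vF // !linear0.
apply: coord_vbasis_inj => i; rewrite linear0.
pose l : 'Hom(V, k^o) := (linfun (coord (vbasis fullv) i : V -> k^o) \o e x)%VF.
have lE w : l w = coord (vbasis fullv) i (e x w) by rewrite comp_lfunE lfunE.
rewrite -lE; apply: (dP (x - y) (fun u' => l (rho (iota u') (e y v)))) du.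
- split=> [|t u']; first exact: (rep_regular (rep_comp rho iota)).
  rewrite gconjE !rep_actMv -alg_homV [rho _ (e y v)](weight_proj_weight eP y v).
  rewrite !lE [e x _](weight_proj_comm eP) !linearZ /= char_valD char_valN char_valV.
  by rewrite mulrA.
- move=> Cxy; apply: mx; apply: pre_le_trans my _; exact: Cxy.
Qed.

(* The stabilizer of F in iota(U) is closed, and open as it contains a
   neighbourhood of 1; connectedness does the rest. *)
Lemma weight_mfilt_stable g v : v \in F -> rho g v \in F.
Proof.
have [[N1 NM NV] _ Nconn _ _] := N_unipotent.
have [d [Ud d1 dP]] := weight_mfilt_near1; have [d' Gd' dE] := iota_closed ex Ud.
pose B1 : set G := [set g | forall v, v \in F -> rho g v \in F].
(* Within [iota(U)] this is the complement of [B1], written as an intersection of zero sets: for [p]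
   in the stabilizer, the points of [iota(U)] where the translate of [d'] by [p] is nonzero stay in
   [B1]. *)
pose B2 : set G := [set g | forall p, range iota p -> B1 p -> d' (p^-1 * g)%g = 0].
have B1M p q : B1 p -> B1 q -> B1 (p * q)%g.
  by move=> B1p B1q w wF; rewrite rep_actMv; apply: B1p; exact: B1q.
have B11 : B1 1%g by move=> w; rewrite rep_act1 id_lfunE.
have d'1 : d' 1%g = 1 by rewrite -d1 dE /= alg_hom1.
have closed1 : zariski_closed B1.
  exists [set f | exists w (l : 'Hom(V, k^o)), [/\ w \in F, forall z, z \in F -> l z = 0 &
      f = fun g => l (rho g w)]].
    by move=> _ [w [l [_ _ ->]]]; exact: rep_regular.
  apply/seteqP; split=> [h B1h _ [w [l [wF lF ->]]]|h hP w wF]; first by apply: lF; exact: B1h.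
  apply: contraT => /separating_form[l [lF]]; case/negP; apply/eqP.
  by apply: (hP (fun g => l (rho g w))); exists w, l.
have closed2 : zariski_closed B2.
  exists [set f | exists p, [/\ range iota p, B1 p & f = fun g => d' (p^-1 * g)%g]].
    by move=> _ [p [_ _ ->]]; exact: regular_translate.
  apply/seteqP; split=> [h B2h _ [p [Np B1p ->]]|h hP p Np B1p]; first exact: B2h.
  by apply: (hP (fun g => d' (p^-1 * g)%g)); exists p.
have cover : range iota `<=` B1 `|` B2.
  move=> h Nh; have [B1h|B1h] := pselect (B1 h); [by left|right] => p Np B1p.
  apply: contrapT => /eqP dh; apply: B1h.
  have [u _ uE] : range iota (p^-1 * h)%g by apply: (NM); [exact: NV|].
  rewrite -[h](mulVKg p) -uE; apply: B1M => //; apply: dP.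
  by rewrite dE /= uE.
have disj : range iota `&` (B1 `&` B2) = set0.
  apply/seteqP; split=> // h [Nh [B1h B2h]].
  by have := B2h h Nh B1h; rewrite mulVg d'1 => /eqP; rewrite oner_eq0.
have NB1 : range iota `<=` B1.
  have [//|NB2] := Nconn B1 B2 closed1 closed2 cover disj.
  by exfalso; suff : set0 (1%g : G) by []; rewrite -disj; split=> //; split=> //; exact: NB2.
(* Any [g] is an element of [iota(U)] times [alpha (pi g)], and the latter acts by a scalar on each
   weight space. *)
move=> vF; have NB := NB1 _ (section_quotient ex alpha g).
rewrite -[g](mulgVK (alpha (pi g))) rep_actMv; apply: NB.
have [S [e eP]] := torus_weight_proj (rep_comp rho alpha) T_torus.
apply/(mem_weight_mfilt ex eP) => x mx.
rewrite [e x _](weight_proj_comm eP) ((mem_weight_mfilt ex eP m v).1 vF x mx).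
exact: scaler0.
Qed.

End Stability.

(** * Independence of the Lie weights and of the cone *)

Section LieWeights.
Variables (k : closedFieldType) (U G T : algGroup k).
Variables (iota : algHom U G) (pi : algHom G T).
Hypothesis ex : short_exact iota pi.
Hypothesis G_solvable : solvable G.
Hypothesis T_torus : torus T.
Hypothesis N_unipotent : connected_normal_unipotent (range iota).

(** A derivation of weight [l] is nonzero on some [alpha]-weight vector in a finite dimensional
    [G]-stable space of functions. That vector is nonzero modulo constants and m^2, so
    [weight_transfer] yields a [beta]-weight vector with the same property, and [lie_weight_fun]
    turns it into a Lie weight for [beta]. *)
Lemma lie_weights_sub (alpha beta : section pi) :
  lie_weights ex alpha `<=` lie_weights ex beta.
Proof.
move=> l [D [Dlie Dw] D0].
have [f [Uf Df]] : exists f, regular U f /\ D f <> 0.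
  apply: contrapT => h; apply: D0; apply: funext => f.
  have [Uf|Uf] := pselect (regular U f); last by have [_ _ ->] := Dlie.
  by apply: contrapT => Df; apply: h; exists f.
have [n [q [sigma [Uq [v0 fE] qE]]]] := conj_rep ex Uf.
have Uc v : regular U (lin_comb q v) by apply: subalg_sum => // i _; exact: subalgZ.
have [S [e eP]] := torus_weight_proj (rep_comp sigma alpha) T_torus.
have [x Dx] : exists x, D (lin_comb q (e x v0)) <> 0.
  apply: contrapT => h; apply: Df; rewrite fE.
  rewrite (_ : lin_comb q v0 = fun u => \sum_(x <- S) lin_comb q (e x v0) u); last first.
    apply: funext => u; rewrite /lin_comb exchange_big; apply: eq_bigr => i _ /=.
    by rewrite -mulr_suml [v0 in LHS](weight_proj_sum eP v0) summxE.
  rewrite (lie_alg_sum Dlie) // big1 // => x _.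
  by apply: contrapT => Dx; apply: h; exists x.
have [_ wx] := rep_weight_fun Uq qE (weight_proj_weight eP x v0).
have lE : l = - x.
  apply: charP => t; have := Dw t _ (Uc (e x v0)); rewrite conj_act_gconj.
  have -> : lin_comb q (e x v0) \o gconj ex (alpha t) =
      fun u => char_val (- x) t * lin_comb q (e x v0) u by exact: funext (wx t).
  by rewrite (lie_algZ Dlie) // => /(mulIf (introN eqP Dx)).
(* This subspace of functions in k + m^2 is [G]-stable, because conjugation fixes 1 and preserves
   m^2; every derivation at 1 vanishes on it. *)
pose Z : set 'rV[k]_n := [set v | max_sq (fun u => lin_comb q v u - lin_comb q v 1%g)].
have ZE z : z \in vspan Z <-> Z z.
  apply: mem_vspan_closed => [|c v w Zv Zw]; rewrite /Z /=.
    rewrite (_ : (fun u => _) = fun=> 0); first exact: max_sq0.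
    by apply: funext => u; rewrite /lin_comb !big1 ?subrr // => i _; rewrite mxE mul0r.
  have linE u : lin_comb q (c *: v + w) u = c * lin_comb q v u + lin_comb q w u.
    rewrite /lin_comb mulr_sumr -big_split /=; apply: eq_bigr => i _.
    by rewrite !mxE mulrDl mulrA.
  rewrite (_ : (fun u => _) = fun u => c * (lin_comb q v u - lin_comb q v 1%g) +
      (lin_comb q w u - lin_comb q w 1%g)); last first.
    by apply: funext => u; rewrite !linE mulrBr opprD addrACA.
  by apply: max_sqD => //; exact: max_sqZ.
have GZ g v : v \in vspan Z -> sigma g v \in vspan Z.
  move=> /ZE Zv; apply/ZE; rewrite /Z /=; have := max_sq_gconj ex g^-1%g Zv.
  rewrite (_ : (fun u => _) = fun u => lin_comb q (sigma g v) u - lin_comb q (sigma g v) 1%g) //.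
  by apply: funext => u; rewrite !qE gconj1.
have exZ : e x v0 \notin vspan Z.
  apply/negP => /ZE Zx; apply: Dx; rewrite -(lie_alg_sub1 Dlie) //.
  by have [] := lie_alg_max_sq Dlie Zx.
have [w [_ wZ wx']] := weight_transfer ex G_solvable T_torus N_unipotent beta (subvf _)
  GZ (fun g v _ => memvf (sigma g v)) (memvf _) exZ (weight_proj_weight eP x v0).
rewrite lE; apply: (lie_weight_fun T_torus (rep_weight_fun Uq qE wx')) => Zw.
by move/negP: wZ; apply; apply/ZE.
Qed.

Lemma weight_cone_section (alpha beta : section pi) :
  weight_cone ex alpha = weight_cone ex beta.
Proof.
rewrite /weight_cone; suff -> : lie_weights ex alpha = lie_weights ex beta by [].
by apply/seteqP; split; exact: lie_weights_sub.
Qed.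

End LieWeights.

Theorem theorem6p3 (k : closedFieldType) (G U T : algGroup k)
    (G_connected : zariski_connected (G := G) setT)
    (G_solvable : solvable G)
    (iota : algHom U G) (pi : algHom G T)
    (ex : short_exact iota pi)
    (U_radical : unipotent_radical (range iota))
    (T_torus : torus T)
    (V : vectType k) (rho : rep G V) :
  (forall alpha beta : section pi,
     weight_cone ex alpha = weight_cone ex beta /\
     forall m : char T,
       weight_mfilt ex rho alpha m = weight_mfilt ex rho beta m) /\
  (forall alpha : section pi,
     [/\ exhaustive (weight_mfilt ex rho alpha),
         separated (weight_mfilt ex rho alpha) &
         regular_mfilt (weight_mfilt ex rho alpha)]).
Proof.
have [N_unipotent _] := U_radical.
split=> [alpha beta|alpha]; last first.
  have [S [e eP]] := torus_weight_proj (rep_comp rho alpha) T_torus.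
  split; [exact: weight_mfilt_exhaustive eP|exact: weight_mfilt_separated eP|].
  exact: weight_mfilt_regular eP.
have CE (a b : section pi) : weight_cone ex a = weight_cone ex b.
  exact: weight_cone_section.
split=> // m; have Fle (a b : section pi) :
    (weight_mfilt ex rho b m <= weight_mfilt ex rho a m)%VS.
  by apply: weight_mfilt_sub => // g v; exact: weight_mfilt_stable.
by apply/eqP; rewrite eqEsubv !Fle.
Qed.
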